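(* Let $q\ge2$ be a prime power and $m\ge1$ an integer. Let $f_q(n,m)$, $I_k$ and $c_q(m)$ be as in the context. Then $$c_q(m)=\frac{1/m}{1-e^{-\gamma}}\sum_{n\ge0}f_q(n,m)\Biggl(\sum_{k=1}^{n+m}\frac{kI_k}{q^k-1}-n\Biggr)\prod_{k=1}^{n+m}\Bigl(1-\frac1{q^k}\Bigr)^{I_k},$$ where $\gamma$ is Euler's constant.
   Context: $\mathbb{F}_q$ is the finite field with $q$ elements. $f_q(n,m)$ is the proportion of polynomials $F$ of degree $n$ over $\mathbb{F}_q$ such that the set of degrees of divisors of $F$ has no gaps of size greater than $m$ (i.e. if $0=d_1<d_2<\dots<d_r=n$ are the degrees of the divisors of $F$, then $d_{i+1}-d_i\le m$). $I_k$ is the number of monic irreducible polynomials of degree $k$ over $\mathbb{F}_q$. It is known that, uniformly for $q\ge2$, $n\ge m\ge1$, $f_q(n,m)=\frac{c_q(m)\,m}{n+m}\{1+O(1/n+m^2/n^2)\}$ for some positive constant $c_q(m)$; this defines $c_q(m)$. *)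

(* Defs.v *)
From HB Require Import structures.
From mathcomp Require Import all_boot all_order all_algebra all_field.
From mathcomp Require Import all_classical all_reals all_analysis.

Set Implicit Arguments.
Unset Strict Implicit.
Unset Printing Implicit Defensive.

Import Order.TTheory GRing.Theory Num.Theory.
Import numFieldNormedType.Exports.

Local Open Scope classical_set_scope.
Local Open Scope ring_scope.

Section PolynomialsOverFiniteField.
Variable F : finFieldType.

(* A polynomial of degree d has size d.+1, so {poly_d.+1 F} contains all the
   polynomials of degree d. *)
Definition has_divisor_of_degree (p : {poly F}) (d : nat) : bool :=
  [exists g : {poly_d.+1 F}, (size g == d.+1) && (g %| p)].

(* The degrees of the divisors of p, for p != 0, in increasing order. *)
Definition divisor_degrees (p : {poly F}) : seq nat :=
  [seq d <- iota 0 (size p) | has_divisor_of_degree p d].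

Definition no_gaps_above (m : nat) (p : {poly F}) : bool :=
  sorted (fun d d' : nat => d' - d <= m)%N (divisor_degrees p).

Definition polys_of_degree (n : nat) : {set {poly_n.+1 F}} :=
  [set p : {poly_n.+1 F} | size p == n.+1].

Definition gap_proportion (R : realType) (n m : nat) : R :=
  #|[set p in polys_of_degree n | no_gaps_above m p]|%:R
  / #|polys_of_degree n|%:R.

Definition num_monic_irreducible (k : nat) : nat :=
  #|[set p in polys_of_degree k |
      ((p : {poly F}) \is monic) && irreducibleb p]|.

(* c is the constant c_q(m), q = #|F|, defined by the asymptotic
   f_q(n,m) = c m / (n + m) * (1 + O(1/n + m^2/n^2)) for n >= m.  The
   implied constant may depend on q and m; c is nevertheless determined, as
   the limit of f_q(n,m) (n + m) / m. *)
Definition is_gap_constant (R : realType) (m : nat) (c : R) : Prop :=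
  0 < c /\
  exists (K : R) (err : R^nat), forall n : nat, (m <= n)%N ->
    gap_proportion R n m = c * m%:R / (n + m)%:R * (1 + err n) /\
    `|err n| <= K * (n%:R^-1 + m%:R ^+ 2 / n%:R ^+ 2).

End PolynomialsOverFiniteField.

(* series harmonic n = 1 + 1/2 + ... + 1/n *)
Definition euler_gamma (R : realType) : R :=
  limn (fun n : nat => series harmonic n - ln n%:R : R).

(* Main.v *)
(* A monic polynomial P factors uniquely as A * B, where the divisor degrees of A have no gap
   larger than m and all the irreducible factors of B have degree > deg A + m.  With
   P_N(x) = prod_(k <= N) (1 - (x/q)^k)^(I_k), this gives

     sum_n f(n) x^n P_(n+m)(x) = 1    (0 <= x < 1),                               (1)

   while P_N(x) --> 1 - x gives the telescoping identity

     sum_n (P_(n+m)(x) - P_(n+m+1)(x)) = P_m(x) - (1 - x)    (0 <= x < 1).        (2)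

   Since f(n) ~ c m / (n + m) and P_N - P_(N+1) ~ P_N x^(N+1) / (N+1), the general term of
   (1) - c m (2) is small enough for the difference to be differentiated termwise at x = 1.
   The derivative at 1 of the general term of (1) is minus the general term of the series of
   the theorem, and that of (2) telescopes: by Mertens' theorem N P_N(1) --> exp(- gamma), so
   P_N'(1) --> - exp(- gamma).  Comparing both sides yields the value c m (1 - exp(- gamma)). *)

Require Import Defs.
From mathcomp Require Import all_boot all_order all_algebra all_field.
From mathcomp Require Import all_classical all_reals all_analysis.
From mathcomp Require Import zify ring lra.
Set Implicit Arguments.
Unset Strict Implicit.
Unset Printing Implicit Defensive.
Import Order.TTheory GRing.Theory Num.Theory.
Import numFieldNormedType.Exports.
Local Open Scope classical_set_scope.
Local Open Scope ring_scope.

(** * The m-dense factor of a polynomial *)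

(** Neither (1) nor (2) may be differentiated termwise at x = 1: the sum in (2) has derivative
    P_m'(1) + 1, while the derivatives of its terms add up to P_m'(1) + exp(- gamma). Subtracting c
    m (2) from (1) removes this defect, and the discrepancy 1 - exp(- gamma) is the origin of that
    factor in the theorem. The core is a bound O(1/n^2), uniform in x, for the difference quotients
    of the combined terms; it is found separately for n below and above 1/(1 - x).

    The arithmetic input is small: q^k (1 - 2/k) <= k I_k <= q^k, from Gauss's formula, and 1 - x <=
    P_N(x) <= 1 - x + x^(N+1), from counting. Mertens' theorem uses the same exchange of limit and
    sum, with no Tauberian argument: ln P_N(x) + sum_(k <= N) x^k / k has terms O(1/k^2) uniformly
    in x and tends to 0 for x < 1, hence also at x = 1. Limits at 1 are taken along x_j = 1 -
    1/(j+1), so that only sequences occur. *)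

Lemma path_filter_iotaP (P : pred nat) (m k a b : nat) :
    (a <= b)%N -> (forall d, (a < d <= b)%N -> ~~ P d) -> P (b + k)%N ->
  reflect (forall t, (a <= t < b + k)%N -> exists2 d, P d & (t < d <= t + m)%N)
    (path (fun d d' : nat => d' - d <= m)%N a [seq d <- iota b.+1 k | P d]).
Proof.
elim: k a b => [|k IH] a b ab nP Pbk /=.
  rewrite addn0 in Pbk *; apply: ReflectT => t /andP[at_ tb].
  by have : ~~ P b; [apply: nP; lia | rewrite Pbk].
rewrite addnS -addSn in Pbk *; case: ifP => Pb1 /=; last first.
  apply: IH => //; first exact: leqW.
  move=> d; case: (eqVneq d b.+1) => [->|db] dP; first by rewrite Pb1.
  by apply: nP; lia.
have {}IH : reflect (forall t, (b.+1 <= t < b.+1 + k)%N ->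
    exists2 d, P d & (t < d <= t + m)%N)
    (path (fun d d' : nat => d' - d <= m)%N b.+1 [seq d <- iota b.+2 k | P d]).
  by apply: IH => // d; lia.
apply: (iffP andP) => [[ba /IH H] t tP|H].
  case: (leqP b.+1 t) => bt; first by apply: H; lia.
  by exists b.+1 => //; lia.
split; last by apply/IH => t tP; apply: H; lia.
have [|d Pd dP] := H a; first by lia.
suff : (b < d)%N by lia.
by rewrite ltnNge; apply: contraL Pd => db; apply: nP; lia.
Qed.

Section MDenseFactor.
Variable F : finFieldType.
Implicit Types (p g P Q A B : {poly F}) (U : seq {poly F}).

Lemma has_divisor_of_degreeP p d :
  reflect (exists2 g : {poly F}, size g = d.+1 & g %| p) (has_divisor_of_degree p d).
Proof.
apply: (iffP existsP) => [[g /andP[/eqP sg gp]]|[g sg gp]]; first by exists g.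
by exists (npolyp d.+1 g); rewrite npolypK ?sg ?eqxx.
Qed.

Definition deg p := (size p).-1.

Lemma size_deg p : p != 0 -> size p = (deg p).+1.
Proof. by rewrite /deg -size_poly_gt0; case: (size p). Qed.

Lemma degM p g : p != 0 -> g != 0 -> deg (p * g) = (deg p + deg g)%N.
Proof.
move=> p0 g0; apply: succn_inj.
by rewrite -size_deg ?mulf_neq0 // size_mul // !size_deg // addnS.
Qed.

Lemma degZ (c : F) p : c != 0 -> deg (c *: p) = deg p.
Proof. by move=> c0; rewrite /deg size_scale. Qed.

Lemma dvdp_deg p g : g != 0 -> p %| g -> (deg p <= deg g)%N.
Proof.
move=> g0 pg; rewrite -ltnS -!size_deg ?dvdp_leq //.
by apply: contraNneq g0 => p0; rewrite -dvd0p -p0.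
Qed.

Lemma irreducible_deg_gt0 p : irreducible_poly p -> (0 < deg p)%N.
Proof. by move=> irrp; rewrite -ltnS -size_deg ?(irredp_neq0 irrp) // irrp.1. Qed.

(** Every threshold [t] is tested, not only the degrees of divisors. This avoids the sorted list of
    degrees and makes density easy to carry over to products. *)
Definition mdense (m : nat) p := forall t, (t < deg p)%N ->
  exists2 g : {poly F}, g %| p & (t < deg g <= t + m)%N.

Lemma no_gaps_aboveP m p : p != 0 -> reflect (mdense m p) (no_gaps_above m p).
Proof.
move=> p0; rewrite /no_gaps_above /divisor_degrees size_deg //=.
have -> : has_divisor_of_degree p 0.
  by apply/has_divisor_of_degreeP; exists 1; rewrite ?size_poly1 ?dvd1p.
have dn : has_divisor_of_degree p (0 + deg p).
  by apply/has_divisor_of_degreeP; exists p; rewrite ?size_deg.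
apply: (iffP (path_filter_iotaP m (leqnn 0) _ dn)) => [d|H t tp|H t tp].
- lia.
- have [//|d /has_divisor_of_degreeP[g sg gp] dt] := H t.
  by exists g => //; rewrite /deg sg.
have [g gp gt] := H t tp; exists (deg g) => //.
apply/has_divisor_of_degreeP; exists g => //; apply: size_deg.
by apply: contraNneq p0 => g0; rewrite -dvd0p -g0.
Qed.

Lemma irreducible_poly_eqp p g : p %= g -> irreducible_poly p -> irreducible_poly g.
Proof.
move=> pg [sp irrp]; split=> [|d d1 dg]; first by rewrite -(eqp_size pg).
have dp : d %| p by rewrite (eqp_dvdr _ pg).
exact: eqp_trans (irrp d d1 dp) pg.
Qed.

Lemma eqp_monic_part p : p != 0 -> (lead_coef p)^-1 *: p %= p.
Proof. by move=> p0; rewrite eqp_scale // invr_eq0 lead_coef_eq0. Qed.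

Lemma monic_part p : p != 0 -> (lead_coef p)^-1 *: p \is monic.
Proof. by move=> p0; rewrite monicE lead_coefZ mulVf // lead_coef_eq0. Qed.

Lemma monic_irreducible_factor p : (1 < size p)%N ->
  exists Q : {poly F}, [/\ irreducible_poly Q, Q \is monic & Q %| p].
Proof.
elim: {p}(size p) {-2}p (leqnn (size p)) => [|n IH] p; first by case: size.
move=> spn sp; have [/irreducibleP irrp|] := boolP (irreducibleb p).
  have p0 := irredp_neq0 irrp; have ep := eqp_monic_part p0.
  exists ((lead_coef p)^-1 *: p); split; last by rewrite (eqp_dvdl _ ep).
    by apply: irreducible_poly_eqp irrp; rewrite eqp_sym.
  exact: monic_part.
rewrite /irreducibleb sp /= negb_forall => /existsP[q].
rewrite negb_imply -ltnNge -Pdiv.Idomain.dvdpE => /andP[qp sq].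
have [|//|Q [? ? Qq]] := IH q; last by exists Q; split=> //; apply: dvdp_trans qp.
have : (size (q : {poly F}) <= (size p).-1)%N := size_npoly q.
by move: (size _) => k kp; apply: leq_trans kp _; rewrite -ltnS prednK // ltnW.
Qed.

Definition rough (y : nat) p :=
  forall Q : {poly F}, irreducible_poly Q -> Q %| p -> (y < deg Q)%N.

Lemma rough_coprimep y g p : rough y p -> g != 0 -> (deg g <= y)%N ->
  coprimep g p.
Proof.
move=> rp g0 gy; apply/coprimepP => d dg dp.
have d0 : d != 0 by apply: contraNneq g0 => d0; rewrite -dvd0p -d0.
rewrite -size_poly_eq1 eqn_leq size_poly_gt0 d0 andbT leqNgt.
apply/negP => /monic_irreducible_factor[Q [irrQ _ Qd]].
have := rp Q irrQ (dvdp_trans Qd dp).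
by rewrite ltnNge (leq_trans _ gy) ?(dvdp_deg g0 (dvdp_trans Qd dg)).
Qed.

(** Below [deg A] the divisors of [A] suffice; from [deg A] to [deg Q] the divisor [Q] itself does,
    by the bound on its degree; above, take [Q] times a divisor of [A] for the threshold
    [t - deg Q]. *)
Lemma dense_mul m A Q : A != 0 -> mdense m A -> Q != 0 ->
  (deg Q <= deg A + m)%N -> mdense m (Q * A).
Proof.
move=> A0 dA Q0 Qm t; rewrite degM // => tQA.
case: (ltnP t (deg A)) => tA.
  by have [g gA gt] := dA t tA; exists g => //; apply: dvdp_mull.
case: (ltnP t (deg Q)) => tQ.
  by exists Q; [apply: dvdp_mulr | lia].
have [|g gA gt] := dA (t - deg Q)%N; first lia.
have g0 : g != 0 by apply: contraNneq A0 => g0; rewrite -dvd0p -g0.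
exists (Q * g); first by rewrite dvdp_mul2l.
rewrite degM //; lia.
Qed.

(* The m-dense factor of [P] is its m-dense divisor of largest degree. *)
Lemma dense_rough_decomposition m P : P \is monic ->
  exists A B : {poly F}, [/\ P = A * B, A \is monic /\ B \is monic, mdense m A
    & rough (deg A + m) B].
Proof.
move=> mP.
pose T d := `[< exists A B : {poly F}, [/\ P = A * B, A \is monic /\ B \is monic,
  mdense m A & deg A = d] >].
have exT : exists d, T d.
  exists 0%N; apply/asboolP; exists 1, P; rewrite mul1r monic1 /deg size_poly1.
  by split=> // t; rewrite /deg size_poly1.
have ubT d : T d -> (d <= deg P)%N.
  move=> /asboolP[A [B [PE _ _ <-]]].
  by apply: dvdp_deg; rewrite ?monic_neq0 // PE dvdp_mulr.
case: (ex_maxnP exT ubT) => d /asboolP[A [B [PE [mA mB] dA sA]]] dmax.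
exists A, B; split=> // Q irrQ QB; rewrite ltnNge; apply/negP => Qs.
have Q0 := irredp_neq0 irrQ.
pose Q' := (lead_coef Q)^-1 *: Q.
have mQ' : Q' \is monic := monic_part Q0.
have Q'B : Q' %| B by rewrite (eqp_dvdl _ (eqp_monic_part Q0)).
have dQ' : deg Q' = deg Q by rewrite degZ // invr_eq0 lead_coef_eq0.
have Q'0 := monic_neq0 mQ'.
(* An irreducible factor of [B] of degree at most [deg A + m] could be moved into [A] without losing
   density, against the maximality of [deg A]. *)
have /dmax : T (deg (Q' * A)).
  apply/asboolP; exists (Q' * A), (B %/ Q').
  have BE : B = B %/ Q' * Q' by rewrite divpK.
  split=> //; first by rewrite PE {1}BE; ring.
    split; first by rewrite monicMl.
    by move: mB; rewrite {1}BE monicMr.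
  by apply: dense_mul; rewrite ?monic_neq0 ?dQ'.
rewrite degM ?monic_neq0 // -sA dQ' leqNgt -[X in (X < _)%N]add0n ltn_add2r.
by rewrite irreducible_deg_gt0.
Qed.

(** If [deg A < deg A'], density of [A'] at the threshold [deg A] gives a divisor [g] of [A'] with
    degree in [(deg A, deg A + m]]. Roughness makes [g] coprime to [B], so [g] divides [A], which is
    too small. Once the degrees are comparable, the same coprimality shows that the dense factors
    divide each other. *)
Lemma dense_rough_decomposition_unique m A B A' B' : A * B = A' * B' ->
    A \is monic -> A' \is monic -> mdense m A -> mdense m A' ->
    rough (deg A + m) B -> rough (deg A' + m) B' ->
  A = A' /\ B = B'.
Proof.
have dvd C D C' D' : C * D = C' * D' -> C \is monic -> C' \is monic ->
    mdense m C' -> rough (deg C + m) D -> (deg C <= deg C')%N -> C' %| C.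
  move=> E mC mC' dC' rD le.
  have C'CD : C' %| C * D by rewrite E dvdp_mulr.
  rewrite -(Gauss_dvdpl _ (_ : coprimep C' D)) //.
  apply: (rough_coprimep rD); first exact: monic_neq0.
  case: (ltnP (deg C) (deg C')) => [/dC'[g gC' gC]|]; last lia.
  have g0 : g != 0.
    by apply: contraTneq gC' => ->; rewrite dvd0p monic_neq0.
  have gD : coprimep g D by apply: (rough_coprimep rD g0); lia.
  have : g %| C by rewrite -(Gauss_dvdpl _ gD) (dvdp_trans gC').
  move/(dvdp_deg (monic_neq0 mC)); lia.
have main C D C' D' : C * D = C' * D' -> C \is monic -> C' \is monic ->
    mdense m C -> mdense m C' -> rough (deg C + m) D ->
    rough (deg C' + m) D' -> (deg C <= deg C')%N -> C = C'.
  move=> E mC mC' dC dC' rD rD' le.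
  have CC' := dvd _ _ _ _ E mC mC' dC' rD le.
  have le' : (deg C' <= deg C)%N by rewrite dvdp_deg // monic_neq0.
  have C'C := dvd _ _ _ _ (esym E) mC' mC dC rD' le'.
  by apply/eqP; rewrite -eqp_monic // /eqp CC' C'C.
move=> E mA mA' dA dA' rB rB'.
have AA' : A = A'.
  case: (leqP (deg A) (deg A')) => [le|/ltnW le].
    exact: main E mA mA' dA dA' rB rB' le.
  exact/esym/(main _ _ _ _ (esym E) mA' mA dA' dA rB' rB le).
by split=> //; move: E; rewrite AA' => /(mulfI (monic_neq0 mA')).
Qed.

End MDenseFactor.

(** * Counting *)

Section Counting.
Variable F : finFieldType.
Implicit Types (p g P Q A B : {poly F}) (U : seq {poly F}).

(** A list in [{poly F}], not a set in a bounded-degree type: factors and products of different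
    degrees then share one type. *)
Definition monics (r : nat) : seq {poly F} :=
  map val (enum [set p in polys_of_degree F r | (p : {poly F}) \is monic]).

Lemma monics_uniq r : uniq (monics r).
Proof. by rewrite map_inj_uniq ?enum_uniq //; apply: val_inj. Qed.

Lemma mem_monics r p : (p \in monics r) = (p \is monic) && (deg p == r).
Proof.
apply/mapP/andP => [[g]|[mp /eqP dp]].
  by rewrite mem_enum !inE => /andP[/eqP sg mg] ->; rewrite /deg sg.
have sp : size p = r.+1 by rewrite size_deg ?monic_neq0 // dp.
have E : npolyp r.+1 p = p :> {poly F} by rewrite npolypK ?sp.
by exists (npolyp r.+1 p) => //; rewrite mem_enum !inE E sp eqxx.
Qed.

Lemma size_monics r : size (monics r) = (#|F| ^ r)%N.
Proof.
rewrite -card_npoly cardT -(size_map (fun p : {poly_r F} => (p : {poly F}) + 'X^r)).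
have sX (p : {poly_r F}) : (size (p : {poly F}) < size ('X^r : {poly F}))%N.
  by rewrite size_polyXn ltnS; apply: size_npoly.
apply/perm_size/uniq_perm; first exact: monics_uniq.
  rewrite map_inj_uniq ?enum_uniq // => p g /addIr; exact: val_inj.
move=> p; rewrite mem_monics; apply/andP/mapP => [[mp /eqP dp]|[g _ ->]].
  have sp : size p = r.+1 by rewrite size_deg ?monic_neq0 // dp.
  have s : (size (p - 'X^r)%R <= r)%N.
    apply/leq_sizeP => j; rewrite leq_eqVlt coefB coefXn => /orP[/eqP <-|rj].
      by move: mp; rewrite monicE lead_coefE sp eqxx => /eqP ->; rewrite subrr.
    by rewrite gtn_eqF // subr0 nth_default // sp.
  exists (NPoly s); first by rewrite mem_enum.
  by rewrite /= subrK.
rewrite /deg addrC size_polyDl // size_polyXn /=; split=> //.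
by rewrite monicE lead_coefDl // lead_coefXn.
Qed.

(** Each polynomial of degree [r] is uniquely a nonzero constant times a monic one. The factor
    [#|F|.-1] cancels in proportions, which reduces everything to monic polynomials. *)
Lemma card_polys_of_degree (T : pred {poly F}) r :
    (forall (c : F) p, c != 0 -> T (c *: p) = T p) ->
  #|[set p in polys_of_degree F r | T p]| = (#|F|.-1 * count T (monics r))%N.
Proof.
move=> TZ; rewrite -size_filter cardE -(size_map val).
have <- : size [seq c <- enum F | c != 0] = #|F|.-1.
  rewrite -(cardC1 (0 : F)) cardE [in RHS]/enum_mem -enumT.
  by congr size; apply: eq_filter.
rewrite -(size_allpairs (fun (c : F) p => c *: p)).
have nz c : c \in [seq c <- enum F | c != 0] -> c != 0 by rewrite mem_filter; case/andP.
apply/perm_size/uniq_perm.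
- by rewrite map_inj_uniq ?enum_uniq //; apply: val_inj.
- apply: allpairs_uniq; rewrite ?filter_uniq -?enumT ?enum_uniq ?monics_uniq //.
  move=> _ _ /allpairsP[[c p] [/nz c0 pr ->]] /allpairsP[[c' p'] [/nz c'0 pr' ->]] /=.
  move: pr pr'; rewrite !mem_filter !mem_monics /= => /and3P[_ mp _] /and3P[_ mp' _].
  move=> E; have := congr1 lead_coef E.
  rewrite !lead_coefZ (monicP mp) (monicP mp') !mulr1 => cc'.
  by move: E; rewrite cc' => /(scalerI c'0) ->.
move=> p; apply/mapP/allpairsP => [[g]|[[c g]]].
  rewrite mem_enum !inE => /andP[/eqP sg Tg] ->.
  have g0 : (g : {poly F}) != 0 by rewrite -size_poly_gt0 sg.
  have lg : lead_coef (g : {poly F}) != 0 by rewrite lead_coef_eq0.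
  exists (lead_coef (g : {poly F}), (lead_coef (g : {poly F}))^-1 *: (g : {poly F})).
  rewrite /= scalerA divff // scale1r !mem_filter lg -?enumT mem_enum; split=> //.
  by rewrite TZ ?invr_eq0 // Tg mem_monics monic_part // degZ ?invr_eq0 // /deg sg /=.
rewrite /= !mem_filter mem_monics => -[/andP[c0 _] /and3P[Tg mg /eqP dg] ->].
have s : size (c *: g) = r.+1 by rewrite size_scale // size_deg ?monic_neq0 // dg.
have E : npolyp r.+1 (c *: g) = c *: g :> {poly F} by rewrite npolypK ?s.
exists (npolyp r.+1 (c *: g)); last exact: (esym E).
by rewrite mem_enum !inE E s eqxx TZ.
Qed.

Lemma no_gaps_aboveZ m (c : F) p : c != 0 -> no_gaps_above m (c *: p) = no_gaps_above m p.
Proof.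
move=> c0; rewrite /no_gaps_above /divisor_degrees size_scale //.
congr sorted; apply: eq_filter => d.
by apply: eq_existsb => g; rewrite dvdpZr.
Qed.

Lemma gap_proportionE (R : realType) n m :
  gap_proportion F R n m = (count (no_gaps_above m) (monics n))%:R / #|F|%:R ^+ n.
Proof.
rewrite /gap_proportion.
have -> : #|polys_of_degree F n| = (#|F|.-1 * #|F| ^ n)%N.
  rewrite -size_monics -count_predT -(card_polys_of_degree (T := predT)) //.
  by apply: eq_card => p; rewrite [in RHS]inE andbT.
rewrite card_polys_of_degree; last by move=> c p; apply: no_gaps_aboveZ.
have q1 : #|F|.-1%:R != 0 :> R.
  by rewrite pnatr_eq0 -lt0n -subn1 subn_gt0 finRing_gt1.
by rewrite !natrM invfM mulrACA mulfV // mul1r natrX.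
Qed.

Lemma num_monic_irreducibleE k :
  num_monic_irreducible F k = count (@irreducibleb F) (monics k).
Proof.
rewrite /num_monic_irreducible -size_filter cardE -(size_map val).
congr size; rewrite /monics filter_map; congr map.
rewrite /enum_mem -filter_predI; apply: eq_filter => p.
by rewrite !inE /= andbA andbC.
Qed.

Definition irreducibles y : seq {poly F} :=
  flatten [seq [seq Q <- monics k | irreducibleb Q] | k <- iota 1 y].

Lemma irreduciblesS y : irreducibles y.+1 =
  irreducibles y ++ [seq Q <- monics y.+1 | irreducibleb Q].
Proof. by rewrite /irreducibles -[y.+1]addn1 iotaD map_cat flatten_cat /= cats0 addn1 add1n. Qed.

Lemma mem_irreducibles y Q : (Q \in irreducibles y) =
  [&& Q \is monic, irreducibleb Q & (deg Q <= y)%N].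
Proof.
elim: y => [|y IH].
  rewrite in_nil; apply/esym/negP => /and3P[_ /irreducibleP/irreducible_deg_gt0].
  by rewrite lt0n leqn0 => /negP.
rewrite irreduciblesS mem_cat IH mem_filter mem_monics [in RHS]leq_eqVlt ltnS.
by case: (Q \is monic); case: irreducibleb => //=; rewrite orbC.
Qed.

Lemma irreducibles_uniq y : uniq (irreducibles y).
Proof.
elim: y => // y IH; rewrite irreduciblesS cat_uniq IH filter_uniq ?monics_uniq //= andbT.
apply/hasPn => Q; rewrite mem_filter mem_monics mem_irreducibles => /and3P[_ _ /eqP ->].
by rewrite ltnn !andbF.
Qed.

(** For [U = irreducibles F y] this counts rough polynomials, by [roughP]. An arbitrary list [U]
    allows induction on one irreducible at a time. *)
Definition coprime_count U r :=
  count (fun p => all (fun Q => ~~ (Q %| p)) U) (monics r).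

Lemma roughP y p : p != 0 ->
  reflect (rough y p) (all (fun Q => ~~ (Q %| p)) (irreducibles y)).
Proof.
move=> p0; apply: (iffP allP) => [H Q irrQ Qp|H Q].
  have Q0 := irredp_neq0 irrQ; rewrite ltnNge; apply/negP => dQ.
  suff /H/negP[] : (lead_coef Q)^-1 *: Q \in irreducibles y.
    by rewrite (eqp_dvdl _ (eqp_monic_part Q0)).
  rewrite mem_irreducibles monic_part // degZ ?invr_eq0 ?lead_coef_eq0 // dQ andbT /=.
  by apply/irreducibleP; apply: irreducible_poly_eqp irrQ; rewrite eqp_sym eqp_monic_part.
rewrite mem_irreducibles => /and3P[_ /irreducibleP irrQ].
by apply: contraTN => Qp; rewrite -ltnNge H.
Qed.

(** One sieve step: the polynomials counted for [U] that [Q] divides are [Q] times those counted in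
    degree [r - deg Q], because [Q] is coprime to every member of [U]. *)
Lemma coprime_count_cons Q U r : Q \is monic -> irreducible_poly Q -> Q \notin U ->
    (forall Q', Q' \in U -> Q' \is monic /\ irreducible_poly Q') ->
  (coprime_count (Q :: U) r + (if deg Q <= r then coprime_count U (r - deg Q) else 0) =
   coprime_count U r)%N.
Proof.
move=> mQ irrQ QU UP.
set a := fun p => all (fun Q => ~~ (Q %| p)) U.
rewrite [RHS]/coprime_count -/a.
have -> : count a (monics r) = (coprime_count (Q :: U) r
    + count (fun p => a p && (Q %| p)%R) (monics r))%N.
  rewrite /coprime_count -[LHS]size_filter -(count_predC (fun p => Q %| p)) addnC.
  rewrite !count_filter; congr addn; apply: eq_count => p /=; rewrite andbC //.
congr addn; have Q0 := monic_neq0 mQ.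
have aM p : a (Q * p) = a p.
  apply: eq_in_all => Q' /[dup] Q'U /UP[mQ' irrQ']; congr negb.
  apply: Gauss_dvdpr; apply/coprimepP => d dQ' dQ; rewrite -size_poly_eq1.
  apply: contraNT QU => d1; have := irrQ'.2 d d1 dQ'; have := irrQ.2 d d1 dQ.
  rewrite eqp_sym => Qd /(eqp_trans Qd); rewrite eqp_monic // => /eqP ->; exact: Q'U.
case: leqP => dQr; last first.
  apply/esym/eqP; rewrite -leqn0 leqNgt -has_count; apply/hasPn => p; rewrite mem_monics => /andP[mp /eqP dp].
  apply: contraL dQr => /andP[_ Qp]; rewrite -leqNgt -dp.
  by apply: dvdp_deg => //; apply: monic_neq0.
rewrite /coprime_count -!size_filter -(size_map (fun p => Q * p)).
apply/perm_size/uniq_perm.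
- by rewrite map_inj_uniq ?filter_uniq ?monics_uniq //; apply: mulfI.
- by rewrite filter_uniq ?monics_uniq.
move=> p; rewrite !mem_filter mem_monics; apply/mapP/and3P => [[g]|].
  rewrite mem_filter mem_monics => /and3P[ag mg /eqP dg] ->.
  split; last 2 first.
  - by rewrite monicMl.
  - by rewrite degM ?monic_neq0 // dg subnKC.
  by apply/andP; split; [rewrite aM; exact: ag | apply: dvdp_mulr].
case=> /andP[ap Qp] mp /eqP dp; exists (p %/ Q); last by rewrite mulrC divpK.
have pE : p = Q * (p %/ Q) by rewrite mulrC divpK.
rewrite mem_filter mem_monics -/(a _) -aM -pE ap /= -(monicMl _ mQ) -pE mp /=.
have g0 : p %/ Q != 0 by apply: contraNneq (monic_neq0 mp) => g0; rewrite pE g0 mulr0.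
by rewrite -dp [in X in _ == (X - _)%N]pE degM // addKn.
Qed.

Lemma coprime_count_irreducibles y r : (0 < r <= y)%N ->
  coprime_count (irreducibles y) r = 0%N.
Proof.
move=> /andP[r0 ry]; apply/eqP; rewrite -leqn0 leqNgt -has_count; apply/hasPn => p.
rewrite mem_monics => /andP[mp /eqP dp]; have p0 := monic_neq0 mp.
apply/negP => /(roughP _ p0) rp.
have [|Q [irrQ mQ Qp]] := @monic_irreducible_factor _ p; first by rewrite size_deg // dp.
by have := rp Q irrQ Qp; have := dvdp_deg p0 Qp; lia.
Qed.

Lemma coprime_count0 U : (forall Q, Q \in U -> irreducible_poly Q) ->
  coprime_count U 0 = 1%N.
Proof.
move=> UP; have -> : 1%N = size (monics 0) by rewrite size_monics.
apply/eqP; rewrite -all_count; apply/allP => p; rewrite mem_monics => /andP[mp /eqP dp].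
apply/allP => Q /UP /irreducible_deg_gt0 Q0; apply/negP => /(dvdp_deg (monic_neq0 mp)).
lia.
Qed.

(** Sorts the monic polynomials of degree [N] by the degree of their dense factor. This is (1)
    divided by 1 - x, read on the coefficient of x^N. *)
Lemma dense_rough_count m N : (#|F| ^ N = \sum_(0 <= n < N.+1)
  count (no_gaps_above m) (monics n) * coprime_count (irreducibles (n + m)) (N - n))%N.
Proof.
pose t n := [seq (A, B) | A <- [seq A <- monics n | no_gaps_above m A],
  B <- [seq B <- monics (N - n)
       | all (fun Q => ~~ (Q %| B)) (irreducibles (n + m))]].
have tP n AB : AB \in t n -> [/\ AB.1 \is monic /\ AB.2 \is monic, deg AB.1 = n,
    deg AB.2 = (N - n)%N, mdense m AB.1 & rough (n + m) AB.2].
  case/allpairsP => -[A B] /= [+ + ->] /=; rewrite !mem_filter !mem_monics.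
  case/and3P => dA mA /eqP sA; case/and3P => rB mB /eqP sB; split=> //.
    exact/no_gaps_aboveP/dA/monic_neq0.
  exact/roughP/rB/monic_neq0.
rewrite -size_monics.
have /perm_size -> : perm_eq (monics N) [seq AB.1 * AB.2 | n <- iota 0 N.+1, AB <- t n].
  apply: uniq_perm; first exact: monics_uniq.
    apply: allpairs_uniq_dep; first exact: iota_uniq.
      move=> n _; apply: allpairs_uniq; rewrite ?filter_uniq ?monics_uniq //.
      by move=> [? ?] [? ?].
    move=> _ _ /allpairsPdep[n [AB [_ /tP[[mA mB] sA _ dA rB] ->]]]
      /allpairsPdep[n' [AB' [_ /tP[[mA' mB'] sA' _ dA' rB'] ->]]] /= E.
    have [] := dense_rough_decomposition_unique E mA mA' dA dA'.
    - by rewrite sA.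
    - by rewrite sA'.
    move=> AA' BB'; have nn' : n = n' by rewrite -sA -sA' AA'.
    have <- : AB = AB' by rewrite [AB]surjective_pairing AA' BB' -surjective_pairing.
    by rewrite nn'.
  move=> P; rewrite mem_monics; apply/andP/allpairsPdep => [[mP /eqP dP]|].
    have [A [B [PE [mA mB] dA rB]]] := dense_rough_decomposition m mP.
    have E : (deg A + deg B)%N = N by rewrite -dP PE degM ?monic_neq0.
    exists (deg A), (A, B); rewrite mem_iota; split=> //; first lia.
    apply/allpairsP; exists (A, B); rewrite !mem_filter !mem_monics mA mB eqxx /=.
    split=> //; first by rewrite andbT; apply/no_gaps_aboveP => //; apply: monic_neq0.
    apply/andP; split; first by apply/roughP => //; apply: monic_neq0.
    by apply/eqP; lia.
  move=> [n [[A B] [nN /tP[/= [mA mB] sA sB _ _] ->]]]; rewrite monicMl // mB; split=> //.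
  by move: nN; rewrite mem_iota degM ?monic_neq0 // sA sB => ?; apply/eqP; lia.
rewrite size_allpairs_dep sumnE big_map /index_iota subn0; apply: eq_bigr => n _.
by rewrite size_allpairs !size_filter.
Qed.

End Counting.


(** * Euler products *)

(** The variable is scaled by [q] so that the critical point is [x = 1], where the factors become
    those of the theorem. *)
Definition euler_factor (R : realType) (q : R) (I : nat -> nat) (x : R) (k : nat) : R :=
  (1 - (x / q) ^+ k) ^+ I k.

Definition euler_product (R : realType) (q : R) (I : nat -> nat) (x : R) (N : nat) : R :=
  \prod_(1 <= k < N.+1) euler_factor q I x k.

Section EulerProduct.
Variable F : finFieldType.
Implicit Types (Q : {poly F}) (U : seq {poly F}).

Definition irreducible_list U :=
  uniq U /\ forall Q, Q \in U -> Q \is monic /\ irreducible_poly Q.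

Lemma irreducible_list_cons Q U : irreducible_list (Q :: U) ->
  [/\ Q \is monic, irreducible_poly Q, Q \notin U & irreducible_list U].
Proof.
move=> [/= /andP[QU uU] UP]; have [mQ irrQ] := UP Q (mem_head _ _).
by split=> //; split=> // Q' Q'U; apply: UP; rewrite in_cons Q'U orbT.
Qed.

Lemma irreducibles_list y : irreducible_list (irreducibles F y).
Proof.
split=> [|Q]; first exact: irreducibles_uniq.
by rewrite mem_irreducibles => /and3P[mQ /irreducibleP].
Qed.

Lemma coprime_count_nil r : coprime_count (F := F) [::] r = (#|F| ^ r)%N.
Proof. by rewrite /coprime_count /= count_predT size_monics. Qed.

Lemma big_irreducibles (T : Type) (idx : T) (op : Monoid.law idx) (G : nat -> T) y :
  \big[op/idx]_(Q <- irreducibles F y) G (deg Q) =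
  \big[op/idx]_(1 <= k < y.+1) iterop (num_monic_irreducible F k) op (G k) idx.
Proof.
rewrite /irreducibles big_flatten big_map /index_iota subSS subn0.
apply: eq_bigr => k _; rewrite num_monic_irreducibleE -size_filter.
set s := [seq Q <- monics F k | irreducibleb Q].
have : {in s, forall Q, deg Q = k}.
  by move=> Q; rewrite mem_filter mem_monics => /and3P[_ _ /eqP].
elim: s => [|Q s IH] sk; first by rewrite big_nil.
rewrite big_cons sk ?mem_head // IH; last first.
  by move=> Q' Q's; rewrite sk // in_cons Q's orbT.
by rewrite !Monoid.iteropE.
Qed.

(** * Truncated power series and Gauss's formula for the number of irreducibles *)

Definition eq_upto (n : nat) (a b : {poly int}) := forall i, (i <= n)%N -> a`_i = b`_i.

Lemma eq_uptoM n a a' b b' :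
  eq_upto n a a' -> eq_upto n b b' -> eq_upto n (a * b) (a' * b').
Proof.
move=> aa' bb' i iN; rewrite !coefM; apply: eq_bigr => j _.
have ji : (j <= i)%N by rewrite -ltnS.
by rewrite aa' ?bb' // ?(leq_trans _ iN) // leq_subr.
Qed.

Let euler_poly U : {poly int} := \prod_(Q <- U) (1 - 'X^(deg Q)).

(** The second factor is the truncated zeta function, counting all monic polynomials; each factor
    [1 - 'X^(deg Q)] performs the sieve step [coprime_count_cons] on its coefficients. *)
Let coef_euler_poly n U i : irreducible_list U -> (i <= n)%N ->
  (euler_poly U * \poly_(k < n.+1) (#|F| ^ k)%:Z)`_i = (coprime_count U i)%:Z.
Proof.
elim: U i => [|Q U IH] i.
  by rewrite /euler_poly big_nil mul1r coef_poly ltnS => _ ->; rewrite coprime_count_nil.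
move=> /irreducible_list_cons[mQ irrQ QU lU] iN.
rewrite /euler_poly big_cons -/(euler_poly U) -mulrA mulrC mulrBr mulr1 coefB coefMXn.
rewrite IH // -(coprime_count_cons i mQ irrQ QU lU.2).
case: leqP => di; last by rewrite subr0 addn0.
by rewrite IH ?(leq_trans (leq_subr _ _)) // PoszD addrK.
Qed.

(** The Euler product of zeta. Sieving by all irreducibles of degree at most [n] leaves only the
    constant 1 up to degree [n], so the product inverts the zeta series, and so does
    [1 - #|F|%:Z *: 'X]. *)
Let euler_poly_irreducibles n :
  eq_upto n (euler_poly (irreducibles F n)) (1 - #|F|%:Z *: 'X).
Proof.
set p := euler_poly _; set S := \poly_(k < n.+1) (#|F| ^ k)%:Z.
have S1 : eq_upto n (S * (1 - #|F|%:Z *: 'X)) 1.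
  move=> i iN; rewrite mulrBr mulr1 -scalerAr coefB coefZ coefMX !coef_poly coef1 ltnS iN.
  case: i iN => [|i] iN /=; first by rewrite mulr0 subr0.
  by rewrite ltnS ltnW // expnS PoszM subrr.
have pS : eq_upto n (p * S) 1.
  move=> i iN; rewrite coef_euler_poly //; last exact: irreducibles_list.
  rewrite coef1; case: i iN => [|i] iN.
    by rewrite coprime_count0 // => Q /(irreducibles_list n).2[].
  by rewrite coprime_count_irreducibles.
have E : eq_upto n (p * (S * (1 - #|F|%:Z *: 'X))) (p * 1) by apply: eq_uptoM.
have E' : eq_upto n (p * S * (1 - #|F|%:Z *: 'X)) (1 * (1 - #|F|%:Z *: 'X)).
  exact: eq_uptoM.
by move=> i iN; rewrite -[p]mulr1 -E // mulrA E' // mul1r.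
Qed.

(** The guard [0 < l] is needed because every degree divides 0, while a logarithmic derivative times
    ['X] has no constant term. *)
Let divisor_sum U (l : nat) : int :=
  \sum_(Q <- U | (0 < l)%N && (deg Q %| l)%N) (deg Q)%:Z.

(* [X p' / p = - sum_Q sum_(j >= 1) (deg Q) X^(j deg Q)] for the Euler product [p], with the
   denominator cleared and read modulo [X^(n+1)]. *)
Let euler_poly_logder n U : irreducible_list U ->
  eq_upto n ('X * (euler_poly U)^`() + \poly_(l < n.+1) divisor_sum U l * euler_poly U) 0.
Proof.
elim: U => [|Q U IH].
  rewrite /euler_poly big_nil derivC mulr0 add0r mulr1 => _ i iN.
  by rewrite coef_poly /divisor_sum big_nil coef0 if_same.
move=> /irreducible_list_cons[mQ irrQ QU lU].
have d0 := irreducible_deg_gt0 irrQ; set d := deg Q in d0 *.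
pose Td := \poly_(l < n.+1) (if (0 < l)%N && (d %| l)%N then d%:Z else 0).
have -> : \poly_(l < n.+1) divisor_sum (Q :: U) l = \poly_(l < n.+1) divisor_sum U l + Td.
  apply/polyP => i; rewrite coefD !coef_poly; case: ifP => // _.
  by rewrite /divisor_sum big_cons; case: ifP => _; rewrite ?addr0 // addrC.
(* [Td] truncates the sum of d X^(jd) over j >= 1, that is d X^d / (1 - X^d). *)
have Td1 : eq_upto n (Td * (1 - 'X^d)) ('X^d *+ d).
  move=> i iN; rewrite mulrBr mulr1 coefB coefMXn coefMn coefXn !coef_poly ltnS iN.
  case: (ltngtP i d) => [id|di|->].
  - rewrite subr0 mul0rn; case: ifP => // /andP[i0 /(dvdn_leq i0)].
    by rewrite leqNgt id.
  - rewrite mul0rn ltnS (leq_trans (leq_subr _ _)) // subn_gt0 di (ltn_trans d0 di).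
    have -> : (d %| i - d)%N = (d %| i)%N.
      by rewrite -[in RHS](subnK (ltnW di)) dvdn_addl.
    by rewrite subrr.
  - by rewrite subnn d0 dvdnn /= subr0 natz.
rewrite /euler_poly big_cons -/(euler_poly U) derivM derivB derivC derivXn -/d.
set p := euler_poly U; set T := \poly_(l < n.+1) divisor_sum U l.
have E (x y z a b t u : {poly int}) : y = x * z ->
    x * ((0 - z *+ d) * a + (1 - y) * b) + (t + u) * ((1 - y) * a) =
    (x * b + t * a) * (1 - y) + a * (u * (1 - y) - y *+ d).
  by move=> ->; rewrite -[z *+ d]mulr_natl -[_ *+ d]mulr_natl; ring.
rewrite E; last by rewrite -exprS prednK.
move=> i iN; rewrite coefD [X in X + _](eq_uptoM (IH lU) (b' := 1 - 'X^d)) // mul0r.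
rewrite (@eq_uptoM n p p _ 0) // ?mulr0 ?coef0 ?addr0 // => j jn.
by rewrite coefB Td1 // subrr coef0.
Qed.

(** Gauss's formula, obtained by comparing the logarithmic derivatives of the Euler product and of 1
    - qX. *)
Lemma sum_num_monic_irreducible n : (0 < n)%N ->
  (\sum_(1 <= d < n.+1 | d %| n) d * num_monic_irreducible F d = #|F| ^ n)%N.
Proof.
move=> n0; have lU := irreducibles_list n.
set p := euler_poly (irreducibles F n); set T := \poly_(l < n.+1) divisor_sum (irreducibles F n) l.
(* From X p' + T p = 0 and p = 1 - qX modulo X^(n+1) one gets T (1 - qX) = qX, so the coefficients
   of [T] start with q and then grow by the factor q. *)
have H i : (i <= n)%N -> (T * (1 - #|F|%:Z *: 'X))`_i = #|F|%:Z *+ (i == 1)%N.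
  move=> iN; have := euler_poly_logder lU iN.
  rewrite coefD (@eq_uptoM n T T _ (1 - #|F|%:Z *: 'X)) //.
  rewrite coef0 => /eqP; rewrite addrC addr_eq0 => /eqP ->.
  rewrite coefXM coef_deriv; case: i iN => [|i] iN /=; first by rewrite oppr0.
  rewrite euler_poly_irreducibles // coefB coef1 coefZ coefX /= sub0r mulNrn opprK.
  by case: i iN => [|i] iN; rewrite /= ?mulr1 ?mulr0 ?mul0rn.
have Ti i : (0 < i <= n)%N -> divisor_sum (irreducibles F n) i = (#|F| ^ i)%:Z.
  move=> /andP[i0 iN]; have -> : divisor_sum (irreducibles F n) i = T`_i.
    by rewrite coef_poly ltnS iN.
  elim: i i0 iN => // i IH _ iN; have := H _ iN.
  rewrite mulrBr mulr1 -scalerAr coefB coefZ coefMX /=.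
  have T0 : T`_0 = 0 by rewrite coef_poly /= /divisor_sum big1.
  case: i IH iN => [|i] IH iN.
    by rewrite T0 mulr0 subr0 expn1.
  by rewrite IH ?(ltnW iN) // => /eqP; rewrite mulr0n subr_eq0 -PoszM -expnS => /eqP.
apply/eqP; rewrite -eqz_nat -Ti ?n0 ?leqnn // /divisor_sum n0 /=.
rewrite [X in _ == X]big_mkcond [eqbRHS](big_irreducibles _ (fun d => if (d %| n)%N then d%:Z else 0)).
rewrite -natz natr_sum [eqbLHS]big_mkcond; apply/eqP/eq_bigr => d _.
rewrite Monoid.iteropE [RHS]iter_addr_0 natz PoszM -[X in _ * X]natz mulr_natr.
by case: ifP => // _; rewrite mul0rn.
Qed.

Lemma muln_num_monic_irreducible_le k : (0 < k)%N ->
  (k * num_monic_irreducible F k <= #|F| ^ k)%N.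
Proof.
move=> k0; rewrite -sum_num_monic_irreducible // big_mkcond /=.
by rewrite (@big_nat_recr _ _ _ k) //= dvdnn leq_addl.
Qed.

(** Says k I_k >= q^k (1 - 2/k) with the denominator cleared. In Gauss's formula the proper divisors
    of [k] are at most k/2 and contribute at most a geometric sum, below q^(k/2+1) with k/2 rounded
    down. *)
Lemma muln_num_monic_irreducible_ge k : (0 < k)%N ->
  (k * #|F| ^ k <= k * (k * num_monic_irreducible F k) + 2 * #|F| ^ k)%N.
Proof.
move=> k0; have q2 : (2 <= #|F|)%N := finRing_gt1 F; set q := #|F| in q2 *.
have geom h : (\sum_(1 <= d < h.+1) q ^ d <= q ^ h.+1)%N.
  elim: h => [|h IH]; first by rewrite big_geq.
  rewrite big_nat_recr //= (leq_trans (leq_add IH (leqnn _))) //.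
  by rewrite addnn -mul2n [leqRHS]expnS leq_mul2r q2 orbT.
have tail : (q ^ k <= k * num_monic_irreducible F k + q ^ k./2.+1)%N.
  rewrite -{1}sum_num_monic_irreducible // big_mkcond (@big_nat_recr _ _ _ k) //= dvdnn.
  rewrite addnC leq_add2l (leq_trans _ (geom k./2)) //.
  rewrite (big_cat_nat (n := k./2.+1)) //=; last by rewrite ltn_half_double; lia.
  rewrite [X in (_ + X)%N](_ : _ = 0%N); last first.
    rewrite big_nat_cond big1 // => d /andP[/andP[kd dk] _].
    case: ifP => // /dvdnP[[|[|c]] kE]; rewrite kE in k0 kd dk; [lia|lia|].
    by move: kd; rewrite ltn_half_double; lia.
  rewrite addn0; apply: leq_sum => d _; case: ifP => // _.
  case: (posnP d) => [-> //|d0]; exact: muln_num_monic_irreducible_le.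
(* After cancelling powers of q this is k <= 2 q^e with e = k - k/2 - 1; it follows from e + 1 <=
   2^e and q >= 2. *)
have expk : (k * q ^ k./2.+1 <= 2 * q ^ k)%N.
  have h : (k./2 < k)%N by rewrite ltn_half_double; lia.
  rewrite -[X in (_ <= _ * q ^ X)%N](subnK h) expnD mulnA leq_mul2r.
  apply/orP; right; apply: (@leq_trans (2 * 2 ^ (k - k./2.+1))).
    have : (k - k./2.+1 < 2 ^ (k - k./2.+1))%N by apply: ltn_expl.
    have := odd_double_half k; rewrite -addnn; lia.
  by case: (k - _)%N => // e; rewrite leq_mul2l leq_exp2r.
rewrite (leq_trans (leq_mul (leqnn k) tail)) // mulnDr leq_add2l //.
Qed.

Variable R : realType.
Let q : R := #|F|%:R.

(** Induction on [U]: without sieving the series is geometric, and a further [Q] multiplies the sum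
    by its factor, since [coprime_count_cons] subtracts the series shifted by [deg Q]. *)
Lemma cvg_coprime_count_series U (x : R) : irreducible_list U -> 0 <= x < 1 ->
  series (fun r => (coprime_count U r)%:R * (x / q) ^+ r) @ \oo -->
  (\prod_(Q <- U) (1 - (x / q) ^+ deg Q)) / (1 - x).
Proof.
have q0 : q != 0 by rewrite pnatr_eq0 -lt0n (ltnW (finRing_gt1 F)).
elim: U => [|Q U IH] lU x01.
  rewrite big_nil; have -> : (fun r => (coprime_count (F := F) [::] r)%:R * (x / q) ^+ r) = geometric 1 x.
    apply: funext => r; rewrite coprime_count_nil natrX -/q /= mul1r -exprMn.
    by rewrite mulrC divfK.
  by apply: cvg_geometric_series; rewrite ger0_norm; case/andP: x01.
have [mQ irrQ QU {}lU] := irreducible_list_cons lU.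
rewrite big_cons -mulrA mulrBl mul1r.
set u := fun r => _ in IH; have {IH}cu := IH lU x01.
set z := x / q; set d := deg Q.
have E r : (coprime_count (Q :: U) (r + d))%:R * z ^+ (r + d) = u (r + d)%N - z ^+ d * u r.
  rewrite /u -(coprime_count_cons (r + d) mQ irrQ QU lU.2) leq_addl addnK natrD exprD; ring.
have E' r : (r < d)%N -> (coprime_count (Q :: U) r)%:R * z ^+ r = u r.
  move=> rd; rewrite /u -(coprime_count_cons r mQ irrQ QU lU.2) leqNgt rd addn0 //.
rewrite -(cvg_shiftn d).
have -> : (fun n => series (fun r => (coprime_count (Q :: U) r)%:R * z ^+ r) (n + d)%N) =
          (fun n => series u (n + d)%N - z ^+ d * series u n).
  apply/funext => n; elim: n => [|n IH].
    rewrite add0n [series u 0]big_geq // mulr0 subr0.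
    by apply: eq_big_nat => r /andP[_ rd]; apply: E'.
  rewrite addSn !seriesSr IH E; ring.
by apply: cvgB; [rewrite (cvg_shiftn d) | apply: cvgM => //; apply: cvg_cst].
Qed.

Lemma prod_irreducibles (x : R) y :
  \prod_(Q <- irreducibles F y) (1 - (x / q) ^+ deg Q) = euler_product q (num_monic_irreducible F) x y.
Proof.
rewrite [LHS](big_irreducibles _ (fun d => 1 - (x / q) ^+ d)); apply: eq_bigr => k _.
by rewrite Monoid.iteropE [LHS]iter_mulr_1.
Qed.

Let P : R -> nat -> R := euler_product q (num_monic_irreducible F).

(** [P x N / (1 - x)] is the generating function of the rough polynomials: its term 0 is 1, terms 1
    to [N] vanish, and each later term lies between 0 and [x ^+ r]. *)
Lemma euler_product_gf_bounds x N : 0 <= x < 1 -> 1 - x <= P x N <= 1 - x + x ^+ N.+1.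
Proof.
move=> /[dup] x01' /andP[x0 x1].
have := cvg_coprime_count_series (irreducibles_list N) x01'.
rewrite prod_irreducibles -/(P x N).
set u := fun r => _ => cu.
have q_gt0 : 0 < q by rewrite ltr0n ltnW ?finRing_gt1.
have u0 : u 0%N = 1.
  by rewrite /u coprime_count0 ?mulr1 // => Q /(irreducibles_list N).2[].
have uN r : (0 < r <= N)%N -> u r = 0.
  by move=> rN; rewrite /u coprime_count_irreducibles // mul0r.
have ur r : 0 <= u r <= x ^+ r.
  rewrite /u mulr_ge0 ?exprn_ge0 ?divr_ge0 ?(ltW q_gt0) //= expr_div_n.
  rewrite mulrCA ler_piMr ?exprn_ge0 // ler_pdivrMr ?exprn_gt0 // mul1r /q -natrX ler_nat.
  by rewrite -size_monics; apply: count_size.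
have x1' : 0 < 1 - x by rewrite subr_gt0.
have lo K : (0 < K)%N -> 1 <= series u K.
  move=> K0; rewrite /series /= big_ltn // u0 lerDl sumr_ge0 // => r _.
  by case/andP: (ur r).
have hi K : (N < K)%N -> series u K <= 1 + x ^+ N.+1 / (1 - x).
  move=> NK; rewrite /series /= (big_cat_nat (n := N.+1)) //=.
  rewrite big_ltn // u0 big_nat_cond big1 => [|r /andP[rN _]]; last exact: uN.
  rewrite addr0 lerD2l.
  apply: (@le_trans _ _ (\sum_(N.+1 <= r < K) x ^+ r)).
    by apply: ler_sum => r _; case/andP: (ur r).
  have E : (\sum_(N.+1 <= r < K) x ^+ r) * (1 - x) = x ^+ N.+1 - x ^+ K.
    rewrite -[RHS]opprB -telescope_sumr // -sumrN mulr_suml.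
    by apply: eq_bigr => r _; rewrite exprS; ring.
  by rewrite ler_pdivlMr // E gerBl exprn_ge0.
apply/andP; split.
  rewrite -[leLHS]mul1r -ler_pdivlMr //; apply: (ler_cvg_to (f := fun=> 1) _ cu); first exact: cvg_cst.
  by exists 1%N.
suff : P x N / (1 - x) <= 1 + x ^+ N.+1 / (1 - x).
  by rewrite ler_pdivrMr // mulrDl mul1r divfK // gt_eqF.
apply: (ler_cvg_to (g := fun=> 1 + x ^+ N.+1 / (1 - x)) cu); first exact: cvg_cst.
by exists N.+1.
Qed.

End EulerProduct.

(** * Real analysis *)

Section RealLemmas.
Variable R : realType.
Implicit Types (a b c l t x y C : R) (u v : nat -> R).

Lemma subrXX_bounds a b n : 0 <= b -> b <= a -> a <= 1 ->
  n%:R * b ^+ n * (a - b) <= a ^+ n - b ^+ n <= n%:R * (a - b).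
Proof.
move=> b0 ba a1; have b1 : b <= 1 := le_trans ba a1.
elim: n => [|n /andP[IH1 IH2]]; first by rewrite !mul0r !expr0 subrr lexx.
have bn1 : b ^+ n <= 1 by apply: exprn_ile1.
have bn0 : 0 <= b ^+ n by apply: exprn_ge0.
have ab0 : 0 <= a - b by rewrite subr_ge0.
have E : a ^+ n.+1 - b ^+ n.+1 = a * (a ^+ n - b ^+ n) + (a - b) * b ^+ n.
  rewrite !exprS; ring.
have d0 : 0 <= a ^+ n - b ^+ n by rewrite subr_ge0 lerXn2r ?nnegrE ?(le_trans b0).
rewrite E -(natr1 n) exprS; apply/andP; split.
  apply: (@le_trans _ _ (b * (n%:R * b ^+ n * (a - b)) + (a - b) * b ^+ n)).
    have : (a - b) * (b * b ^+ n) <= (a - b) * b ^+ n.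
      by rewrite ler_wpM2l // ler_piMl.
    lra.
  rewrite lerD2r; apply: ler_pM => //; rewrite ?mulr_ge0 //.
rewrite [leRHS]mulrDl mul1r lerD // ?(le_trans _ IH2) ?ler_piMl //.
by rewrite mulrC ler_piMl.
Qed.

Lemma exprn_ge1Nn t n : 0 <= t <= 1 -> 1 - n%:R * t <= (1 - t) ^+ n.
Proof.
move=> /andP[t0 t1]; elim: n => [|n IH]; first by rewrite mul0r subr0 expr0.
rewrite exprS; apply: (@le_trans _ _ ((1 - t) * (1 - n%:R * t))).
  rewrite -(natr1 n); have : 0 <= n%:R * t * t by rewrite !mulr_ge0.
  lra.
by rewrite ler_wpM2l // subr_ge0.
Qed.

Lemma cvg_le_bound u l a b M : u @ \oo --> l -> (forall n, (M <= n)%N -> `|u n - a| <= b) ->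
  `|l - a| <= b.
Proof.
move=> ul H; have ul' : (fun n => `|u n - a|) @ \oo --> `|l - a|.
  by apply: cvg_norm; apply: cvgB => //; apply: cvg_cst.
apply: (ler_cvg_to ul' (cvg_cst b)).
by exists M => // n /= Mn; apply: H.
Qed.

Lemma cvg_inv_natS C : (fun n => C / n.+1%:R) @ \oo --> (0 : R).
Proof.
rewrite -[0](mulr0 C); apply: cvgM; first exact: cvg_cst.
exact: cvg_harmonic.
Qed.

Lemma sum_inv_consecutive C M K : (M <= K)%N ->
  \sum_(M <= n < K) C / (n.+1%:R * n.+2%:R) = C / M.+1%:R - C / K.+1%:R.
Proof.
move=> MK; rewrite -[RHS]opprB -!(telescope_sumr (fun n => C / n.+1%:R)) // -sumrN.
apply: eq_bigr => n _; rewrite -[n.+2%:R]natr1.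
have n1 : n.+1%:R != 0 :> R by rewrite pnatr_eq0.
have n2 : n.+1%:R + 1 != 0 :> R by rewrite natr1 pnatr_eq0.
field; exact/andP.
Qed.

Lemma cvg_sum_nat (g : nat -> nat -> R) (g1 : nat -> R) M :
    (forall n, (fun j => g j n) @ \oo --> g1 n) ->
  (fun j => \sum_(0 <= n < M) g j n) @ \oo --> \sum_(0 <= n < M) g1 n.
Proof.
move=> gg1; elim: M => [|M IH].
  by rewrite big_geq //; under eq_fun do rewrite big_geq //; apply: cvg_cst.
rewrite big_nat_recr //=; under eq_fun do rewrite big_nat_recr //=.
by apply: cvgD => //; apply: gg1.
Qed.

(** Dominated convergence for series. The majorant telescopes, so the tail after [M] terms is at
    most [C / M.+1%:R] for every [j]; letting [j] grow at fixed [M] gives the same bound for [l] and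
    the partial sums of [g1]. *)
Lemma tannery C (g : nat -> nat -> R) (g1 h : nat -> R) l :
    (forall j n, `|g j n| <= C / (n.+1%:R * n.+2%:R)) ->
    (forall n, (fun j => g j n) @ \oo --> g1 n) ->
    (forall j, series (g j) @ \oo --> h j) -> h @ \oo --> l ->
  series g1 @ \oo --> l.
Proof.
move=> gC gg1 gh hl.
have C0 : 0 <= C.
  have := le_trans (normr_ge0 _) (gC 0%N 0%N).
  by rewrite pmulr_lge0 // invr_gt0 mulr_gt0.
have head j M : `|h j - series (g j) M| <= C / M.+1%:R.
  apply: (cvg_le_bound (M := M) (gh j)) => K MK.
  rewrite sub_series_geq //; apply: le_trans (ler_norm_sum _ _ _) _.
  apply: le_trans (ler_sum _ (fun n _ => gC j n)) _.
  by rewrite sum_inv_consecutive // gerBl divr_ge0.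
have cg M : (fun j => series (g j) M) @ \oo --> series g1 M by apply: cvg_sum_nat.
have main M : `|l - series g1 M| <= C / M.+1%:R.
  have H : (fun j => h j - series (g j) M) @ \oo --> l - series g1 M by apply: cvgB.
  rewrite -[l - _]subr0; apply: (cvg_le_bound (M := 0%N) H) => j _.
  by rewrite subr0.
apply/cvgrPdist_le => e e0; have := cvg_inv_natS C.
move=> /cvgrPdist_le/(_ e e0) [N _ HN]; exists N => // n Nn.
apply: le_trans (main n) _; have := HN n Nn.
by rewrite /= sub0r normrN ger0_norm // divr_ge0.
Qed.

Lemma ln_natS n : (0 < n)%N -> ln n.+1%:R = ln n%:R + ln (1 + n%:R^-1) :> R.
Proof.
move=> n0; have n0' : 0 < n%:R :> R by rewrite ltr0n.
rewrite -lnM ?posrE ?addr_gt0 ?invr_gt0 //; congr ln.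
by rewrite mulrDr mulr1 divff ?natr1 // gt_eqF.
Qed.

Lemma series_harmonic_ge_ln n : ln n.+1%:R <= series harmonic n :> R.
Proof.
elim: n => [|n IH]; first by rewrite ln1 /series /= big_geq.
rewrite seriesSr ln_natS // lerD //= le_ln1Dx // (lt_trans (ltrN10 R)) // invr_gt0 ltr0n //.
Qed.

Lemma cvg_euler_gamma :
  (fun n => series harmonic n - ln n%:R : R) @ \oo --> euler_gamma R.
Proof.
apply: (@near_nonincreasing_is_cvgn _ _ 0).
  exists 1%N => // n /= n1 m nm.
  rewrite -(subnKC nm); elim: (m - n)%N => [|d IH]; first by rewrite addn0.
  apply: le_trans _ IH; rewrite addnS seriesSr ln_natS ?ltn_addr //.
  set k := (n + d)%N; have k0 : 0 < k%:R :> R by rewrite ltr0n ltn_addr.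
  have k1 : 0 < k.+1%:R :> R by rewrite ltr0n.
  suff : k.+1%:R^-1 <= ln (1 + k%:R^-1) :> R.
    have E (X A B D : R) : D <= B -> X + D - (A + B) <= X - A by lra.
    exact: E.
  (* The lower bound for the logarithm comes from ln(1 + t) <= t applied to the inverse of 1 + 1/k,
     which is 1 - 1/(k+1). *)
  rewrite -[X in ln X]invrK lnV ?posrE ?invr_gt0 ?addr_gt0 ?invr_gt0 //.
  have -> : (1 + k%:R^-1)^-1 = 1 + (- k.+1%:R^-1) :> R.
    rewrite -(natr1 k) in k1 *; field; by rewrite !gt_eqF //= addrC natr1.
  rewrite lerNr le_ln1Dx // ltrN2 invf_lt1 // ltr1n; rewrite /k; lia.
exists 1%N => // n /= n1; rewrite subr_ge0; apply: le_trans (series_harmonic_ge_ln n).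
by rewrite ler_ln ?posrE ?ltr0n // ler_nat.
Qed.

(** Makes the denominator 1 - exp(- gamma) nonzero. The companion sequence with [ln n.+2%:R]
    increases from 1 - ln 2, and 2 = (3/2)(4/3) gives ln 2 <= 1/2 + 1/3. *)
Lemma euler_gamma_gt0 : 0 < euler_gamma R.
Proof.
have l2 : ln 2 < 1 :> R.
  have -> : 2 = (1 + 2^-1) * (1 + 3^-1) :> R by field.
  have h2 : ln (1 + 2^-1) <= 2^-1 :> R by apply: le_ln1Dx; lra.
  have h3 : ln (1 + 3^-1) <= 3^-1 :> R by apply: le_ln1Dx; lra.
  rewrite lnM ?posrE; lra.
apply: (@lt_le_trans _ _ (1 - ln 2)); first by rewrite subr_gt0.
apply: (ler_cvg_to (cvg_cst _) cvg_euler_gamma).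
have mono n : 1 - ln 2 <= series harmonic n.+1 - ln n.+2%:R :> R.
  elim: n => [|n IH]; first by rewrite /series /= big_nat1 invr1.
  apply: le_trans IH _; rewrite [series _ n.+2]seriesSr [ln n.+3%:R]ln_natS //.
  have E (S L a b : R) : a <= b -> S - L <= S + b - (L + a) by lra.
  apply: E; apply: le_ln1Dx; apply: (@lt_le_trans _ _ 0); first by lra.
  by rewrite invr_ge0.
exists 1%N => // -[//|n] _ /=; apply: le_trans (mono n) _.
by rewrite lerD2l lerN2 ler_ln ?posrE ?ltr0n // ler_nat.
Qed.

(** Mean value theorem for the expression inside the norm: it vanishes at 0 and has derivative - t^N
    / (1 - t). *)
Lemma series_log_bound x N : 0 <= x < 1 ->
  `|series (fun k => x ^+ k.+1 / k.+1%:R) N + ln (1 - x)| <= x ^+ N / (1 - x).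
Proof.
move=> /andP[x0 x1].
pose p : {poly R} := \sum_(0 <= k < N) k.+1%:R^-1 *: 'X^(k.+1).
pose f := horner p + (@ln R \o (fun t => 1 - t)).
have pE t : p.[t] = series (fun k => t ^+ k.+1 / k.+1%:R) N.
  rewrite /p horner_sum; apply: eq_bigr => k _.
  by rewrite hornerZ hornerXn mulrC.
have fE t : f t = p.[t] + ln (1 - t) by [].
have p'E t : t != 1 -> p^`().[t] = (1 - t ^+ N) / (1 - t).
  move=> t1; rewrite /p raddf_sum horner_sum.
  rewrite (eq_bigr (fun k => geometric 1 t k)) => [|k _].
    by rewrite -[LHS]/(series (geometric 1 t) N) geometric_seriesE //= mul1r.
  rewrite /= derivZ derivXn hornerZ hornerMn hornerXn /= mul1r.
  by rewrite -[t ^+ k *+ _]mulr_natl mulKf // pnatr_eq0.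
have df t : t < 1 -> is_derive t 1 f (- (t ^+ N / (1 - t))).
  move=> t1; have t1' : 0 < 1 - t by rewrite subr_gt0.
  have d1 : is_derive t 1 (fun t : R => 1 - t) (0 - 1) by apply: is_deriveB.
  have d2 : is_derive t 1 (@ln R \o (fun t : R => 1 - t)) ((1 - t)^-1 * (0 - 1)).
    by have d3 := is_derive1_ln t1'; apply: is_derive1_comp.
  apply: is_derive_eq; rewrite p'E ?lt_eqF //.
  field; by rewrite gt_eqF.
have cf : {within `[0, x], continuous f}.
  apply: derivable_within_continuous => t; rewrite in_itv /= => /andP[_ tx].
  by case: (df t (le_lt_trans tx x1)).
have [|c] := @MVT_segment R f (fun t => - (t ^+ N / (1 - t))) 0 x x0 _ cf.
  by move=> t; rewrite in_itv /= => /andP[_ tx]; apply: df; apply: lt_trans x1.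
rewrite in_itv /= => /andP[c0 cx].
have -> : f 0 = 0.
  rewrite fE pE subr0 ln1 addr0 /series /= big1 // => k _.
  by rewrite expr0n mul0r.
rewrite !subr0 => fx; rewrite -pE -fE fx normrM normrN.
have c1 : 0 < 1 - c by rewrite subr_gt0 (le_lt_trans cx).
have x1' : 0 < 1 - x by rewrite subr_gt0.
have q0 : 0 <= c ^+ N / (1 - c) by rewrite divr_ge0 ?exprn_ge0 // ltW.
rewrite !ger0_norm // -[leRHS]mulr1 ler_pM // ?(ltW x1) //.
apply: ler_pM; rewrite ?exprn_ge0 ?invr_ge0 ?(ltW c1) //.
  by rewrite lerXn2r ?nnegrE.
by rewrite lef_pV2 ?posrE // lerB.
Qed.

Lemma cvg_series_log x : 0 <= x < 1 ->
  series (fun k => x ^+ k.+1 / k.+1%:R) @ \oo --> - ln (1 - x).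
Proof.
move=> x01; have /andP[x0 x1] := x01.
have c0 : (fun N => x ^+ N / (1 - x)) @ \oo --> (0 : R).
  rewrite -[0](mul0r (1 - x)^-1); apply: cvgM; last exact: cvg_cst.
  by apply: cvg_expr; rewrite ger0_norm.
apply/cvgrPdist_le => e e0; move/cvgrPdist_le: c0 => /(_ e e0)[N _ HN].
exists N => // n Nn; have := HN n Nn => /=.
rewrite sub0r normrN ger0_norm ?divr_ge0 ?exprn_ge0 ?subr_ge0 ?(ltW x1) //.
apply: le_trans; rewrite -normrN opprB opprK; exact: series_log_bound.
Qed.

End RealLemmas.

(** * Mertens' theorem and termwise differentiation *)

Section EulerFactors.
Variables (R : realType) (q : R) (I : nat -> nat).
Hypothesis q_ge2 : 2 <= q.
Hypothesis I_le : forall k, (0 < k)%N -> k%:R * (I k)%:R <= q ^+ k.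
Hypothesis I_ge : forall k, (0 < k)%N ->
  k%:R * q ^+ k <= k%:R * (k%:R * (I k)%:R) + 2 * q ^+ k.
Implicit Types (x y : R).
Let P := euler_product q I.
Let e := euler_factor q I.

Let q_gt0 : 0 < q.
Proof. by apply: lt_le_trans q_ge2. Qed.

Definition irreducible_density (k : nat) : R := (I k)%:R / q ^+ k.
Let d := irreducible_density.

Lemma irreducible_density_le k : (0 < k)%N -> d k <= k%:R^-1.
Proof.
move=> k0; rewrite /d /irreducible_density ler_pdivrMr ?exprn_gt0 // ler_pdivlMl ?ltr0n //.
exact: I_le.
Qed.

Lemma irreducible_density_ge0 k : 0 <= d k.
Proof. by rewrite divr_ge0 // exprn_ge0 // ltW. Qed.

Lemma irreducible_density_ge k : (0 < k)%N -> k%:R^-1 - 2 / k%:R ^+ 2 <= d k.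
Proof.
move=> k0; have k0' : 0 < k%:R :> R by rewrite ltr0n.
have Q0 : 0 < q ^+ k by rewrite exprn_gt0.
have := I_ge k0.
have -> : (I k)%:R = d k * q ^+ k by rewrite divfK // gt_eqF.
rewrite !mulrA -mulrDl ler_pM2r // => H.
rewrite -(ler_pM2l (_ : 0 < k%:R * k%:R)) ?mulr_gt0 //.
have -> : k%:R * k%:R * (k%:R^-1 - 2 / k%:R ^+ 2) = k%:R - 2 :> R.
  field; by rewrite gt_eqF.
by rewrite lerBlDr /d /irreducible_density mulrA.
Qed.

Lemma euler_productS x N : P x N.+1 = P x N * e x N.+1.
Proof. by rewrite /P /euler_product big_nat_recr. Qed.

Lemma euler_product0 x : P x 0 = 1.
Proof. by rewrite /P /euler_product big_geq. Qed.

Lemma expr_divq_bounds x k : 0 <= x <= 1 -> (0 < k)%N -> 0 <= (x / q) ^+ k <= 2^-1.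
Proof.
move=> /andP[x0 x1] k0; have xq0 : 0 <= x / q by rewrite divr_ge0 // ltW.
have xq : x / q <= 2^-1.
  by rewrite ler_pdivrMr // (le_trans x1) // ler_pdivlMl // mulr1.
rewrite exprn_ge0 //=; case: k k0 => // k _; rewrite exprS -[leRHS]mulr1.
apply: ler_pM => //; rewrite ?exprn_ge0 // exprn_ile1 // (le_trans xq) //.
by rewrite invf_le1 // ler1n.
Qed.

Lemma euler_factor_bounds x k : 0 <= x <= 1 -> (0 < k)%N -> 0 < e x k <= 1.
Proof.
move=> x01 k0; have /andP[a0 a1] := expr_divq_bounds x01 k0.
rewrite exprn_gt0 /=; last by lra.
by rewrite exprn_ile1 //; lra.
Qed.

Lemma euler_product_bounds x N : 0 <= x <= 1 -> 0 < P x N <= 1.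
Proof.
move=> x01; elim: N => [|N /andP[IH1 IH2]]; first by rewrite euler_product0 ltr01 lexx.
have /andP[e0 e1] := euler_factor_bounds x01 (ltn0Sn N).
by rewrite euler_productS mulr_gt0 //= mulr_ile1 // ltW.
Qed.

Lemma euler_product_nonincreasing x N M : 0 <= x <= 1 -> (N <= M)%N -> P x M <= P x N.
Proof.
move=> x01 NM; rewrite -(subnKC NM); elim: (M - N)%N => [|k IH]; first by rewrite addn0.
apply: le_trans _ IH; rewrite addnS euler_productS ler_piMr //.
  by case/andP: (euler_product_bounds (N + k) x01) => /ltW.
by case/andP: (euler_factor_bounds x01 (ltn0Sn (N + k))).
Qed.

(** A mean value estimate for a power with exponent [I k]. The loss 1 - 1/k bounds (1 -
    (y/q)^k)^(I_k) >= 1 - I_k (y/q)^k >= 1 - [d k] from below. *)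
Lemma euler_factor_diff x y k : 0 <= x -> x <= y -> y <= 1 -> (0 < k)%N ->
  (1 - k%:R^-1) * d k * (y ^+ k - x ^+ k) <= e x k - e y k <= d k * (y ^+ k - x ^+ k).
Proof.
move=> x0 xy y1 k0; have y0 := le_trans x0 xy.
have x01 : 0 <= x <= 1 by rewrite x0 (le_trans xy).
have y01 : 0 <= y <= 1 by rewrite y0.
have /andP[a0 a1] := expr_divq_bounds x01 k0.
have /andP[b0 b1] := expr_divq_bounds y01 k0.
have D : d k * (y ^+ k - x ^+ k) = (I k)%:R * ((1 - (x / q) ^+ k) - (1 - (y / q) ^+ k)).
  by rewrite /d /irreducible_density !expr_div_n; ring.
have D0 : 0 <= d k * (y ^+ k - x ^+ k).
  by rewrite mulr_ge0 ?irreducible_density_ge0 // subr_ge0 lerXn2r ?nnegrE.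
have ab : (x / q) ^+ k <= (y / q) ^+ k.
  by rewrite lerXn2r ?nnegrE ?divr_ge0 ?(ltW q_gt0) // ler_wpM2r ?invr_ge0 ?(ltW q_gt0).
have /andP[L U] := @subrXX_bounds R (1 - (x / q) ^+ k) (1 - (y / q) ^+ k) (I k)
  ltac:(lra) ltac:(lra) ltac:(lra).
rewrite [X in _ <= _ <= X]D U andbT; apply: le_trans L.
have -> : (I k)%:R * (1 - (y / q) ^+ k) ^+ I k * ((1 - (x / q) ^+ k) - (1 - (y / q) ^+ k))
    = (1 - (y / q) ^+ k) ^+ I k * (d k * (y ^+ k - x ^+ k)) by rewrite D mulrCA mulrA.
rewrite -mulrA ler_wpM2r //.
have H := @exprn_ge1Nn R ((y / q) ^+ k) (I k) ltac:(lra).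
apply: le_trans H.
rewrite lerD2l lerN2; apply: le_trans (irreducible_density_le k0).
rewrite /d /irreducible_density expr_div_n mulrA ler_wpM2r ?invr_ge0 ?exprn_ge0 ?(ltW q_gt0) //.
by rewrite ler_piMr // exprn_ile1.
Qed.

(** The constant 3 adds the error 2/k^2 in [d k] and the loss (1/k) [d k] <= 1/k^2 of
    [euler_factor_diff]. *)
Lemma euler_factor_diff_approx x y k : 0 <= x -> x <= y -> y <= 1 -> (0 < k)%N ->
  `|e x k - e y k - (y ^+ k - x ^+ k) / k%:R| <= 3 / k%:R ^+ 2 * (y ^+ k - x ^+ k).
Proof.
move=> x0 xy y1 k0; have /andP[] := euler_factor_diff x0 xy y1 k0.
set D := y ^+ k - x ^+ k => L U.
have D0 : 0 <= D by rewrite subr_ge0 lerXn2r ?nnegrE // (le_trans x0).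
have := irreducible_density_le k0; have := irreducible_density_ge k0.
have := irreducible_density_ge0 k; rewrite -exprVn => d0 dg dl.
set r := k%:R^-1 in L dg dl *.
have r0 : 0 <= r by rewrite invr_ge0.
have U' : d k * D <= r * D by rewrite ler_wpM2r.
have L1 : (r - 2 * r ^+ 2) * D <= d k * D by rewrite ler_wpM2r.
have L2 : r * d k * D <= r ^+ 2 * D by rewrite ler_wpM2r // expr2 ler_wpM2l.
have D1 : 0 <= r ^+ 2 * D by rewrite mulr_ge0 // exprn_ge0.
rewrite ler_norml; apply/andP; split; lra.
Qed.

Lemma subr1X_le x k : 0 <= x <= 1 -> 1 - x ^+ k <= k%:R * (1 - x).
Proof.
move=> /andP[x0 x1]; have := @exprn_ge1Nn R (1 - x) k; rewrite subKr => H.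
have /H : 0 <= 1 - x <= 1 by lra.
by move: (_ * _) (x ^+ k) => a b; lra.
Qed.

(** Each factor changes by a proportion of at most 2 (1 - x), and the changes add up. Keeping
    [P x N] on the right preserves its decay in [N], which [T_quotient_bound] needs. *)
Lemma euler_product_diff x N : 0 <= x <= 1 ->
  P x N - P 1 N <= 2 * N%:R * (1 - x) * P x N.
Proof.
move=> x01; have /andP[x0 x1] := x01.
have i01 : (0 : R) <= (1 : R) <= 1 by rewrite ler01 lexx.
have step k : (0 < k)%N -> e x k - e 1 k <= 2 * (1 - x) * e x k.
  move=> k0; have /andP[a0 a1] := expr_divq_bounds x01 k0.
  have /andP[b0 b1] := expr_divq_bounds i01 k0.
  have ab : (x / q) ^+ k <= (1 / q) ^+ k.
    by rewrite lerXn2r ?nnegrE ?divr_ge0 ?(ltW q_gt0) // ler_wpM2r ?invr_ge0 ?(ltW q_gt0).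
  set s := (x / q) ^+ k in a0 a1 ab; set t := (1 / q) ^+ k in b0 b1 ab.
  (* The difference of the two sides is (t - s)(1 - 2s), nonnegative because s <= 1/2. *)
  have E : (1 - s) * (1 - 2 * (t - s)) <= 1 - t.
    have : 0 <= (t - s) * (1 - 2 * s) by apply: mulr_ge0; lra.
    lra.
  have E2 : (1 - s) ^+ I k * (1 - 2 * (t - s)) ^+ I k <= (1 - t) ^+ I k.
    by rewrite -exprMn lerXn2r ?nnegrE ?mulr_ge0 //; lra.
  have E3 : 1 - (I k)%:R * (2 * (t - s)) <= (1 - 2 * (t - s)) ^+ I k.
    by apply: exprn_ge1Nn; lra.
  have E4 : (I k)%:R * (t - s) <= 1 - x.
    have -> : (I k)%:R * (t - s) = d k * (1 - x ^+ k).
      by rewrite /d /irreducible_density /s /t !expr_div_n expr1n; ring.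
    apply: (@le_trans _ _ (k%:R^-1 * (k%:R * (1 - x)))).
      apply: ler_pM; rewrite ?irreducible_density_ge0 ?irreducible_density_le ?subr1X_le //.
      by rewrite subr_ge0 exprn_ile1.
    by rewrite mulKf // pnatr_eq0 -lt0n.
  have /andP[e0 _] := euler_factor_bounds x01 k0.
  have E5 : e x k * (1 - 2 * (1 - x)) <= e 1 k.
    apply: le_trans E2; rewrite ler_pM2l //; apply: le_trans E3; lra.
  lra.
elim: N => [|N IH]; first by rewrite !euler_product0 subrr mulr0 !mul0r.
have /andP[P0 _] := euler_product_bounds N x01.
have /andP[e0 _] := euler_factor_bounds x01 (ltn0Sn N).
have /andP[e10 _] := euler_factor_bounds i01 (ltn0Sn N).
have e1x : e 1 N.+1 <= e x N.+1.
  have /andP[L _] := euler_factor_diff x0 x1 (lexx 1) (ltn0Sn N).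
  rewrite -subr_ge0; apply: le_trans L; apply: mulr_ge0.
    apply: mulr_ge0; last exact: irreducible_density_ge0.
    by rewrite subr_ge0 invf_le1 ?ltr0n // ler1n.
  by rewrite subr_ge0 expr1n exprn_ile1.
have := step N.+1 isT.
rewrite !euler_productS -(natr1 N) => st.
have H1 : P x N * (e x N.+1 - e 1 N.+1) <= P x N * (2 * (1 - x) * e x N.+1).
  by rewrite ler_pM2l.
have H2 : (P x N - P 1 N) * e 1 N.+1 <= 2 * N%:R * (1 - x) * P x N * e x N.+1.
  apply: (@le_trans _ _ (2 * N%:R * (1 - x) * P x N * e 1 N.+1)).
    by rewrite ler_pM2r.
  by rewrite ler_wpM2l // !mulr_ge0 ?subr_ge0 // ltW.
lra.
Qed.

(** A Mertens upper bound, uniform for x within 1/N of 1. The exponent 5 is 4 + 1: 4 from the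
    telescoping majorant of the sum of 2/k^2, and 1 from N (1 - x) <= 1. *)
Lemma euler_product_le x N : 0 <= x <= 1 -> N%:R * (1 - x) <= 1 ->
  P x N <= expR 5 / N.+1%:R.
Proof.
move=> x01 Nx; have /andP[x0 x1] := x01.
have step k : (0 < k)%N ->
    e x k <= expR (- k%:R^-1 + (4 / k%:R - 4 / k.+1%:R) + (1 - x)).
  move=> k0; have /andP[a0 a1] := expr_divq_bounds x01 k0.
  apply: (@le_trans _ _ (expR (- (x / q) ^+ k) ^+ I k)).
    rewrite lerXn2r ?nnegrE ?expR_ge0 //; first lra.
    exact: expR_ge1Dx.
  rewrite -expRM_natl ler_expR mulrN.
  have -> : (I k)%:R * (x / q) ^+ k = d k * x ^+ k.
    by rewrite /d /irreducible_density expr_div_n; ring.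
  have k0' : 0 < k%:R :> R by rewrite ltr0n.
  have A : d k * (1 - x ^+ k) <= 1 - x.
    apply: (@le_trans _ _ (k%:R^-1 * (k%:R * (1 - x)))).
      apply: ler_pM; rewrite ?irreducible_density_ge0 ?irreducible_density_le ?subr1X_le //.
      by rewrite subr_ge0 exprn_ile1.
    by rewrite mulKf // gt_eqF.
  have B := irreducible_density_ge k0.
  have C : 2 / k%:R ^+ 2 <= 4 / k%:R - 4 / k.+1%:R :> R.
    have -> : 4 / k%:R - 4 / k.+1%:R = 4 / (k%:R * (k%:R + 1)) :> R.
      rewrite -(natr1 k); move: (k%:R : R) k0' => z z0.
      by field; apply/andP; split; apply: lt0r_neq0; lra.
    rewrite ler_pdivlMr ?mulr_gt0 ?addr_gt0 // mulrAC ler_pdivrMr ?exprn_gt0 //.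
    have : 1 <= k%:R :> R by rewrite ler1n.
    move: (k%:R : R) => z z1; rewrite expr2; nra.
  have E (D X r t v z : R) : D * (1 - X) <= z -> r - t <= D -> t <= v ->
    - (D * X) <= - r + v + z by lra.
  exact: E A B C.
have main : P x N <= expR (- series harmonic N + (4 - 4 / N.+1%:R) + N%:R * (1 - x)).
  elim: N {Nx} => [|N IH].
    by rewrite euler_product0 /series /= big_geq // divr1 subrr oppr0 !add0r mul0r expR0.
  have -> : N.+1%:R * (1 - x) = N%:R * (1 - x) + (1 - x) by rewrite -(natr1 N); ring.
  rewrite euler_productS seriesSr.
  have /andP[P0 _] := euler_product_bounds N x01.
  have /andP[e0 _] := euler_factor_bounds x01 (ltn0Sn N).
  apply: le_trans (ler_pM (ltW P0) (ltW e0) IH (step N.+1 isT)) _.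
  have E (S h a b nd z : R) :
    - S + (4 - a) + nd + (- h + (a - b) + z) <= - (S + h) + (4 - b) + (nd + z) by lra.
  by rewrite -expRD ler_expR; apply: E.
apply: le_trans main _.
have -> : expR 5 / N.+1%:R = expR (5 - ln N.+1%:R) :> R.
  by rewrite [RHS]expRD expRN lnK // posrE ltr0n.
rewrite ler_expR.
have := series_harmonic_ge_ln R N.
have : 0 <= 4 / N.+1%:R :> R by rewrite divr_ge0.
have E (S L a z : R) : z <= 1 -> 0 <= a -> L <= S -> - S + (4 - a) + z <= 5 - L by lra.
exact: E.
Qed.

(** * Mertens' theorem by passing to the limit x = 1 *)

Hypothesis euler_product_gf : forall x N, 0 <= x < 1 -> 1 - x <= P x N <= 1 - x + x ^+ N.+1.

Lemma cvg_euler_product x : 0 <= x < 1 -> P x @ \oo --> 1 - x.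
Proof.
move=> /[dup] x01 /andP[x0 x1].
have cx : (fun N => x ^+ N.+1) @ \oo --> (0 : R).
  by rewrite (cvg_shiftS (fun N => x ^+ N)); apply: cvg_expr; rewrite ger0_norm.
apply: (squeeze_cvgr (f := fun=> 1 - x) (h := fun N => 1 - x + x ^+ N.+1)).
- by exists 0%N => // N _; apply: euler_product_gf.
- exact: cvg_cst.
rewrite -[X in _ --> X]addr0; apply: cvgD => //; exact: cvg_cst.
Qed.


(** Logarithm of an Euler factor with its main part - x^k / k removed, k = n + 1. The sum over [n]
    is ln(1 - x) - ln(1 - x) = 0 for x < 1. *)
Let G x n : R := (I n.+1)%:R * ln (1 - (x / q) ^+ n.+1) + x ^+ n.+1 / n.+1%:R.

Lemma expr_divq_le_inv x k : 0 <= x <= 1 -> (0 < k)%N -> (x / q) ^+ k <= k%:R^-1.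
Proof.
move=> /andP[x0 x1] k0; rewrite expr_div_n; apply: (@le_trans _ _ (q ^+ k)^-1).
  by rewrite ler_piMl ?invr_ge0 ?exprn_ge0 ?(ltW q_gt0) // exprn_ile1.
rewrite lef_pV2 ?posrE ?exprn_gt0 ?ltr0n //.
apply: (@le_trans _ _ (2 ^+ k)); last by rewrite lerXn2r ?nnegrE // ltW.
by rewrite -natrX ler_nat ltnW // ltn_expl.
Qed.

Lemma inv_sqr_le k : (0 < k)%N -> k%:R ^- 2 <= 2 / (k%:R * k.+1%:R) :> R.
Proof.
move=> k0; have k1 : 1 <= k%:R :> R by rewrite ler1n.
rewrite -(natr1 k); move: (k%:R : R) k1 => z z1.
rewrite ler_pdivlMr; last by apply: mulr_gt0; lra.
rewrite mulrC ler_pdivrMr; last by apply: exprn_gt0; lra.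
rewrite expr2; nra.
Qed.

Lemma ln1B_bounds y : 0 <= y <= 2^-1 -> - y - 2 * y ^+ 2 <= ln (1 - y) <= - y.
Proof.
move=> /andP[y0 y1]; apply/andP; split; last by apply: le_ln1Dx; lra.
have y2 : 0 < 1 - y by lra.
have -> : ln (1 - y) = - ln (1 + y / (1 - y)).
  rewrite -lnV ?posrE; first by congr ln; field; apply/andP; split; lra.
  by apply: ltr_wpDr => //; rewrite divr_ge0 // ltW.
have H : ln (1 + y / (1 - y)) <= y / (1 - y).
  apply: le_ln1Dx; apply: (@lt_le_trans _ _ 0); first by lra.
  by rewrite divr_ge0 // ltW.
have : y / (1 - y) <= y + 2 * y ^+ 2.
  rewrite ler_pdivrMr // expr2; nra.
lra.
Qed.

(** The second order terms of the logarithm and the error in [d k] leave at most 2/k^2, and 1/k^2 <=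
    2/(k(k+1)); hence 4. *)
Lemma log_factor_bound x n : 0 <= x <= 1 -> `|G x n| <= 4 / (n.+1%:R * n.+2%:R).
Proof.
move=> x01; have k0 := ltn0Sn n; set k := n.+1 in k0 *.
have /andP[x0 x1] := x01.
have y01 := expr_divq_bounds x01 k0; have y1 := expr_divq_le_inv x01 k0.
have D : (I k)%:R * (x / q) ^+ k = d k * x ^+ k.
  by rewrite /d /irreducible_density expr_div_n mulrCA mulrC.
have := irreducible_density_ge k0; have := irreducible_density_le k0.
have d0 := irreducible_density_ge0 k; rewrite -exprVn => dl dg.
have X0 : 0 <= x ^+ k by rewrite exprn_ge0.
have X1 : x ^+ k <= 1 by rewrite exprn_ile1.
have /andP[L U] := ln1B_bounds y01; have /andP[y0 _] := y01.
have i0 : 0 <= (I k)%:R :> R by [].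
have := inv_sqr_le k0; rewrite -exprVn -/k.
rewrite /G -/k; move: L U D; set y := (x / q) ^+ k in y0 y1 *.
set r := k%:R^-1 in y1 dl dg *; set l := ln _ => L U D r2.
have A1 : (I k)%:R * l <= - (d k * x ^+ k) by rewrite -D -mulrN ler_wpM2l.
have A2 : - (d k * x ^+ k) - 2 * (d k * x ^+ k * y) <= (I k)%:R * l.
  apply: le_trans (ler_wpM2l i0 L); rewrite -D le_eqVlt; apply/orP; left; apply/eqP; ring.
have A3 : d k * x ^+ k * y <= r ^+ 2.
  rewrite expr2; apply: ler_pM => //; first exact: mulr_ge0.
  by apply: le_trans dl; rewrite ler_piMr.
have A4 : d k * x ^+ k <= r * x ^+ k by rewrite ler_wpM2r.
have A5 : (r - 2 * r ^+ 2) * x ^+ k <= d k * x ^+ k by rewrite ler_wpM2r.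
have A6 : r ^+ 2 * x ^+ k <= r ^+ 2 by rewrite ler_piMr // exprn_ge0 // invr_ge0.
have E (a b c' e' s t : R) : a <= - b -> - b - 2 * t <= a -> t <= s -> b <= c' ->
  c' - 2 * e' <= b -> e' <= s -> `|a + c'| <= 2 * s.
  by move=> *; rewrite ler_norml; apply/andP; split; lra.
have A7 : r * x ^+ k - 2 * (r ^+ 2 * x ^+ k) <= d k * x ^+ k.
  by apply: le_trans A5; rewrite mulrBl mulrA.
apply: le_trans (_ : 2 * r ^+ 2 <= _).
  rewrite [x ^+ k / _]mulrC; exact: E A1 A2 A3 A4 A7 A6.
apply: le_trans (_ : 2 * (2 / (k%:R * k.+1%:R)) <= _); first by rewrite ler_pM2l.
by rewrite mulrA -natrM.
Qed.

Lemma series_log_factor x N : 0 <= x <= 1 ->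
  series (G x) N = ln (P x N) + series (fun n => x ^+ n.+1 / n.+1%:R) N.
Proof.
move=> x01; elim: N => [|N IH].
  by rewrite euler_product0 ln1 /series /= !big_geq // addr0.
have /andP[P0 _] := euler_product_bounds N x01.
have /andP[e0 _] := euler_factor_bounds x01 (ltn0Sn N).
rewrite !seriesSr IH euler_productS lnM ?posrE // -!addrA; congr (_ + _).
rewrite [RHS]addrCA; congr (_ + _); rewrite /G /e /euler_factor.
have /andP[a0 a1] := expr_divq_bounds x01 (ltn0Sn N).
have b0 : 0 < 1 - (x / q) ^+ N.+1 by move: a1; move: (_ ^+ _) => z; lra.
by rewrite lnXn // mulr_natl.
Qed.

(** Since [1 - xs j] is the inverse of [j.+1%:R], a difference quotient at 1 is a product with
    [j.+1%:R]. *)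
Let xs (j : nat) : R := 1 - j.+1%:R^-1.

Let xs_bounds j : 0 <= xs j < 1.
Proof.
rewrite /xs subr_ge0 invf_le1 ?ltr0n // ler1n /=.
by rewrite gtrBl invr_gt0 ltr0n.
Qed.

Let xs_bounds' j : 0 <= xs j <= 1.
Proof. by have /andP[-> /ltW] := xs_bounds j. Qed.

Let cvg_xs : xs @ \oo --> (1 : R).
Proof.
rewrite -[X in _ --> X]subr0; apply: cvgB; first exact: cvg_cst.
exact: cvg_harmonic.
Qed.

Lemma cvg_expr_seq (u : nat -> R) (l : R) k : u @ \oo --> l -> (fun j => u j ^+ k) @ \oo --> l ^+ k.
Proof.
move=> ul; elim: k => [|k IH]; first exact: cvg_cst.
by rewrite exprS; under eq_fun do rewrite exprS; apply: cvgM.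
Qed.

Let i01 : (0 : R) <= (1 : R) <= 1.
Proof. by rewrite ler01 lexx. Qed.

(** The partial sums of [G 1] are the sequence in question. All [G (xs j)] sum to 0 and share the
    majorant of [log_factor_bound], so [tannery] carries the value 0 to x = 1. *)
Lemma mertens_log : (fun N => ln (P 1 N) + series harmonic N) @ \oo --> (0 : R).
Proof.
have -> : (fun N => ln (P 1 N) + series harmonic N) = series (G 1).
  apply/funext => N; rewrite series_log_factor //; congr (_ + _).
  by apply: eq_bigr => n _; rewrite expr1n div1r.
apply: (tannery (C := 4) (g := fun j => G (xs j)) (h := fun=> 0)).
- by move=> j n; apply: log_factor_bound.
- move=> n; have cx : (fun j => xs j ^+ n.+1) @ \oo --> (1 : R) ^+ n.+1 by apply: cvg_expr_seq.
  have cy : (fun j => (xs j / q) ^+ n.+1) @ \oo --> (1 / q) ^+ n.+1.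
    by apply: cvg_expr_seq; apply: cvgM => //; apply: cvg_cst.
  rewrite /G; apply: cvgD; last by apply: cvgM => //; apply: cvg_cst.
  apply: cvgM; first exact: cvg_cst.
  apply: (@continuous_cvg _ _ _ _ _ _ (@ln R)).
    apply: continuous_ln; have /andP[_] := expr_divq_bounds i01 (ltn0Sn n).
    move: (_ ^+ _) => z; lra.
  by apply: cvgB => //; apply: cvg_cst.
- move=> j; have /andP[x0 x1] := xs_bounds j.
  have -> : series (G (xs j)) =
      (fun N => ln (P (xs j) N) + series (fun n => xs j ^+ n.+1 / n.+1%:R) N).
    by apply/funext => N; apply: series_log_factor.
  rewrite -(subrr (ln (1 - xs j))); apply: cvgD; last exact: cvg_series_log.
  apply: (@continuous_cvg _ _ _ _ _ _ (@ln R)); last exact: cvg_euler_product.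
  by apply: continuous_ln; rewrite subr_gt0.
exact: cvg_cst.
Qed.

Lemma mertens : (fun N => N%:R * P 1 N) @ \oo --> expR (- euler_gamma R).
Proof.
have H : (fun N => ln (P 1 N) + series harmonic N - (series harmonic N - ln N%:R))
    @ \oo --> 0 - euler_gamma R.
  by apply: cvgB; [exact: mertens_log | exact: cvg_euler_gamma].
have H' := @continuous_cvg _ _ _ _ _ _ (@expR R) _ (@continuous_expR R _) H.
rewrite sub0r -cvg_shiftS in H'; rewrite -(cvg_shiftS (fun N => N%:R * P 1 N)).
rewrite (_ : (fun N => N.+1%:R * P 1 N.+1) = (fun N => (expR \o (fun N =>
    ln (P 1 N) + series harmonic N - (series harmonic N - ln N%:R))) N.+1)); first exact: H'.
apply/funext => N; rewrite [RHS]/comp.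
have /andP[P0 _] := euler_product_bounds N.+1 i01.
have E (a b s : R) : a + s - (s - b) = b + a by ring.
by rewrite E expRD !lnK // posrE ltr0n.
Qed.

(** Equals - P_N'(1) / P_N(1), and is the inner sum of the theorem. *)
Definition log_derivative_sum N : R := \sum_(1 <= k < N.+1) (k%:R * (I k)%:R / (q ^+ k - 1)).
Let sg := log_derivative_sum.

(** Cesaro's theorem: the summands k I_k / (q^k - 1) tend to 1. *)
Lemma cvg_log_derivative_sum : (fun N => sg N.+1 / N.+1%:R) @ \oo --> (1 : R).
Proof.
pose u n : R := n.+1%:R * (I n.+1)%:R / (q ^+ n.+1 - 1).
have cu : u @ \oo --> (1 : R).
  pose v n : R := n.+1%:R * d n.+1.
  pose t n : R := 1 - q^-1 ^+ n.+1.
  have ct : t @ \oo --> (1 : R).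
    rewrite -[X in _ --> X]subr0; apply: cvgB; first exact: cvg_cst.
    rewrite (cvg_shiftS (fun n => q^-1 ^+ n)); apply: cvg_expr.
    by rewrite ger0_norm ?invr_ge0 ?(ltW q_gt0) // invf_lt1 // (lt_le_trans _ q_ge2) // ltr1n.
  have cv : v @ \oo --> (1 : R).
    apply: (squeeze_cvgr (f := fun n => 1 - 2 / n.+1%:R) (h := fun=> 1)).
    - exists 0%N => // n _; have n0 : 0 < n.+1%:R :> R by rewrite ltr0n.
      rewrite /v; apply/andP; split.
        rewrite -(ler_pM2l (_ : 0 < n.+1%:R^-1)) ?invr_gt0 // mulKf ?gt_eqF //.
        apply: le_trans (irreducible_density_ge (ltn0Sn n)).
        rewrite le_eqVlt; apply/orP; left; apply/eqP; field; by rewrite gt_eqF.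
      by rewrite mulrC -ler_pdivlMr // div1r irreducible_density_le.
    - rewrite -[X in _ --> X]subr0; apply: cvgB; first exact: cvg_cst.
      exact: cvg_inv_natS.
    - exact: cvg_cst.
  have -> : u = (fun n => v n / t n).
    apply/funext => n; rewrite /u /v /t /d /irreducible_density exprVn.
    have Q1 : 1 < q ^+ n.+1.
      by rewrite exprn_egt1 // (lt_le_trans _ q_ge2) // ltr1n.
    move: (q ^+ n.+1) Q1 => Q Q1; move: (I n.+1)%:R (n.+1%:R) => a b.
    by field; apply/andP; split; apply: lt0r_neq0; lra.
  rewrite -[X in _ --> X](divr1 1); apply: cvgM => //.
  by apply: cvgV; rewrite ?oner_eq0.
rewrite (_ : (fun N => sg N.+1 / N.+1%:R) = arithmetic_mean u); first exact: cesaro.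
by apply/funext => n; rewrite mulrC /sg /log_derivative_sum big_add1.
Qed.

Lemma cvg_euler_product_derivative :
  (fun N => P 1 N * sg N) @ \oo --> expR (- euler_gamma R).
Proof.
rewrite -(cvg_shiftS (fun N => P 1 N * sg N)).
have -> : (fun N => P 1 N.+1 * sg N.+1) =
    (fun N => (N.+1%:R * P 1 N.+1) * (sg N.+1 / N.+1%:R)).
  apply/funext => N; have E (a b s : R) : s != 0 -> b * a = s * b * (a / s).
    by move=> s0; field.
  by apply: E; rewrite pnatr_eq0.
have H : (fun N => N.+1%:R * P 1 N.+1) @ \oo --> expR (- euler_gamma R).
  by rewrite (cvg_shiftS (fun N => N%:R * P 1 N)); apply: mertens.
by have := cvgM H cvg_log_derivative_sum; rewrite mulr1; apply.
Qed.

(* Logarithmic derivative at [1] from the left, tested along the sequence [xs] only. *)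
Let has_logder (phi : R -> R) (L : R) :=
  (fun j => phi (xs j)) @ \oo --> phi 1 /\
  (fun j => (phi 1 - phi (xs j)) * j.+1%:R) @ \oo --> phi 1 * L.

Let has_logder1 : has_logder (fun=> 1) 0.
Proof.
split; first exact: cvg_cst.
by under eq_fun do rewrite subrr mul0r; rewrite mulr0; apply: cvg_cst.
Qed.

Let has_logder_id : has_logder id 1.
Proof.
split; first exact: cvg_xs.
rewrite (_ : (fun j => _) = cst 1); first by rewrite mulr1; apply: cvg_cst.
by apply/funext => j; rewrite /xs /= subKr mulVf // pnatr_eq0.
Qed.

Let has_logderM phi psi L M : has_logder phi L -> has_logder psi M ->
  has_logder (fun x => phi x * psi x) (L + M).
Proof.
move=> [c1 d1] [c2 d2]; split; first exact: cvgM.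
rewrite (_ : (fun j => _) = (fun j => phi 1 * ((psi 1 - psi (xs j)) * j.+1%:R) +
   ((phi 1 - phi (xs j)) * j.+1%:R) * psi (xs j))); last first.
  by apply/funext => j; move: (phi _) (phi _) (psi _) (psi _) => a b a' b'; ring.
rewrite (_ : phi 1 * psi 1 * (L + M) = phi 1 * (psi 1 * M) + (phi 1 * L) * psi 1); last first.
  by move: (phi _) (psi _) => a b; ring.
by apply: cvgD; [apply: cvgM => //; apply: cvg_cst | apply: cvgM].
Qed.

Let has_logderX phi L n : has_logder phi L -> has_logder (fun x => phi x ^+ n) (n%:R * L).
Proof.
move=> pL; elim: n => [|n IH]; first by rewrite mul0r; apply: has_logder1.
rewrite -(natr1 n) addrC mulrDl mul1r.
rewrite (_ : (fun x => _) = (fun x => phi x * phi x ^+ n)); first exact: has_logderM.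
by apply/funext => x; rewrite exprS.
Qed.

Let has_logder_euler_product N : has_logder (P^~ N) (- sg N).
Proof.
elim: N => [|N IH].
  rewrite (_ : (fun x => _) = (fun=> 1)); last by apply/funext => x; rewrite euler_product0.
  by rewrite /sg /log_derivative_sum big_geq // oppr0; apply: has_logder1.
rewrite /sg /log_derivative_sum big_nat_recr //= -/(sg N) opprD.
rewrite (_ : (fun x => _) = (fun x => P x N * e x N.+1)); last first.
  by apply/funext => x; rewrite euler_productS.
apply: has_logderM => //; set k := N.+1.
rewrite (_ : - _ = (I k)%:R * - (k%:R / (q ^+ k - 1))); last first.
  by rewrite mulrN mulrA [_ * k%:R]mulrC.
apply: has_logderX.
have [cX dX] := has_logderX k has_logder_id.
have Q1 : 1 < q ^+ k by rewrite exprn_egt1 // (lt_le_trans _ q_ge2) // ltr1n.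
have E x : 1 - (x / q) ^+ k = 1 - x ^+ k / q ^+ k by rewrite expr_div_n.
split.
  by under eq_fun do rewrite E; rewrite E; apply: cvgB; [exact: cvg_cst|];
    apply: cvgM => //; apply: cvg_cst.
rewrite (_ : (fun j => _) = (fun j => - (q ^+ k)^-1 * ((1 ^+ k - xs j ^+ k) * j.+1%:R))).
  rewrite (_ : _ * _ = - (q ^+ k)^-1 * (1 ^+ k * (k%:R * 1))); last first.
    rewrite E expr1n; move: (q ^+ k) (k%:R : R) Q1 => Q a Q1.
    by field; apply/andP; split; apply: lt0r_neq0; lra.
  by apply: cvgM => //; apply: cvg_cst.
apply/funext => j; rewrite !E; move: (_ ^+ k) (_ ^+ k) (_ ^-1) => a b c; ring.
Qed.

(** * Termwise differentiation at 1; [kappa] stands for c m and [f_gf] is a finite form of (1) *)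

Variables (f : nat -> R) (m : nat) (kappa C : R).
Hypothesis m_gt0 : (0 < m)%N.
Hypothesis f_gf : forall x M, 0 <= x < 1 ->
  1 - x ^+ M <= \sum_(0 <= n < M) f n * x ^+ n * P x (n + m) <= 1.
Hypothesis f_approx : forall n,
  `|f n - kappa / (n + m).+1%:R| <= C / (n.+1%:R * n.+2%:R).

Let K n : R := (n + m).+1%:R.
Let r n : R := (n.+1%:R * n.+2%:R)^-1.

Let K_gt0 n : 0 < K n. Proof. by rewrite ltr0n. Qed.

Let r_gt0 n : 0 < r n. Proof. by rewrite invr_gt0 mulr_gt0. Qed.

Let C_ge0 : 0 <= C.
Proof.
have := le_trans (normr_ge0 _) (f_approx 0).
by rewrite pmulr_lge0 // invr_gt0 mulr_gt0.
Qed.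

Let invK_le n : (K n)^-1 <= n.+1%:R^-1.
Proof. by rewrite lef_pV2 ?posrE ?ltr0n // ler_nat ltnS leq_addr. Qed.

Let invK2_le n : K n ^- 2 <= r n.
Proof.
rewrite /r lef_pV2 ?posrE ?exprn_gt0 ?mulr_gt0 // expr2.
by apply: ler_pM => //; rewrite ler_nat !ltnS ?leq_addr // -{1}[n]addn0 ltn_add2l.
Qed.

Let inv2_le n : n.+1%:R ^- 2 <= 2 * r n.
Proof. exact: inv_sqr_le. Qed.

Let w n x : R := f n * x ^+ n - kappa * (1 - e x (n + m).+1).

(* The terms of the series identity for [f], minus the terms of a telescoping series with
   the same asymptotics; the difference is small enough to be differentiated termwise at 1. *)
Let T n x : R := P x (n + m) * w n x.

Let TE n x : T n x = f n * x ^+ n * P x (n + m) - kappa * (P x (n + m) - P x (n + m).+1).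
Proof. rewrite /T /w euler_productS; move: (e _ _) (P _ _) => a b; ring. Qed.

Let expr_gap_le x n : 0 <= x <= 1 ->
  0 <= (x ^+ n - x ^+ (n + m).+1) / K n <= m.+1%:R * (1 - x) / K n.
Proof.
move=> x01; have /andP[x0 x1] := x01; apply/andP; split.
  by rewrite divr_ge0 ?(ltW (K_gt0 n)) // subr_ge0 ler_wiXn2l // ltnW // ltnS leq_addr.
rewrite ler_wpM2r ?invr_ge0 ?(ltW (K_gt0 n)) //.
rewrite -addnS exprD -[X in X - _]mulr1 -mulrBr.
apply: le_trans (subr1X_le m.+1 x01); rewrite ler_piMl // ?exprn_ile1 //.
by rewrite subr_ge0 exprn_ile1.
Qed.

(** Add n x^n (1 - x) <= 1 - x^n <= 1 and x^n (1 - x) <= 1. *)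
Let mul_expr_le x n : 0 <= x <= 1 -> x ^+ n * (1 - x) <= 2 / n.+1%:R.
Proof.
move=> /andP[x0 x1]; have /andP[H _] := subrXX_bounds n x0 x1 (lexx 1).
rewrite ler_pdivlMr ?ltr0n // -(natr1 n) mulrDr mulr1 expr1n in H *.
have X0 : 0 <= x ^+ n by rewrite exprn_ge0.
have X1 : x ^+ n <= 1 by rewrite exprn_ile1.
have : x ^+ n * (1 - x) <= 1 by rewrite mulr_ile1 //; lra.
move: (x ^+ n) (n%:R : R) X0 X1 H => X N X0 X1 H; lra.
Qed.

Let C0 := C + `|kappa| * (2 * m.+1%:R + 3).
Let C1 := C + `|kappa| * (m.+1%:R + 3).

Let C0_ge0 : 0 <= C0.
Proof. by rewrite addr_ge0 // mulr_ge0 // addr_ge0 // mulr_ge0. Qed.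

Let C1_ge0 : 0 <= C1.
Proof. by rewrite addr_ge0 // mulr_ge0 // addr_ge0. Qed.

(** Three errors of order 1/n^2: replacing [f n] by [kappa / K n], replacing [1 - e x (n + m).+1] by
    its main part x^K / K, and the mismatch (x^n - x^K) / K, small by [mul_expr_le]. *)
Let w_bound n x : 0 <= x <= 1 -> `|w n x| <= C0 * r n.
Proof.
move=> x01; have /andP[x0 x1] := x01.
have X0 : 0 <= x ^+ n by rewrite exprn_ge0.
have X1 : x ^+ n <= 1 by rewrite exprn_ile1.
have E1 : `|(f n - kappa / K n) * x ^+ n| <= C * r n.
  by rewrite normrM (ger0_norm X0) (le_trans (ler_piMr _ X1)) // f_approx.
have /andP[g0 g1] := expr_gap_le n x01.
have E2 : (x ^+ n - x ^+ (n + m).+1) / K n <= 2 * m.+1%:R * r n.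
  rewrite -addnS exprD -[X in X - _]mulr1 -mulrBr.
  have H1 := subr1X_le m.+1 x01; have H2 := mul_expr_le n x01.
  apply: (@le_trans _ _ (x ^+ n * (m.+1%:R * (1 - x)) / K n)).
    by rewrite ler_wpM2r ?invr_ge0 ?(ltW (K_gt0 n)) // ler_wpM2l.
  rewrite [leLHS](_ : _ = m.+1%:R * (x ^+ n * (1 - x) / K n)); last by ring.
  rewrite [leRHS](_ : _ = m.+1%:R * (2 / n.+1%:R * n.+2%:R^-1)); last first.
    by rewrite /r invfM; ring.
  rewrite ler_wpM2l //; apply: ler_pM => //.
  - by rewrite mulr_ge0 // subr_ge0.
  - by rewrite invr_ge0 ltW.
  by rewrite lef_pV2 ?posrE // ler_nat !ltnS -{1}[n]addn0 ltn_add2l.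
have E3 : `|e 0 (n + m).+1 - e x (n + m).+1 - (x ^+ (n + m).+1 - 0 ^+ (n + m).+1) / K n|
    <= 3 * r n.
  apply: le_trans (euler_factor_diff_approx (lexx 0) x0 x1 (ltn0Sn _)) _.
  rewrite expr0n subr0; apply: (@le_trans _ _ (3 / K n ^+ 2)).
    by rewrite ler_piMr ?exprn_ile1 // divr_ge0 // exprn_ge0.
  by rewrite ler_wpM2l.
have e0 : e 0 (n + m).+1 = 1 by rewrite /e /euler_factor mul0r expr0n subr0 expr1n.
rewrite e0 expr0n subr0 in E3.
have wE : w n x = (f n - kappa / K n) * x ^+ n + kappa * ((x ^+ n - x ^+ (n + m).+1) / K n
    - (1 - e x (n + m).+1 - x ^+ (n + m).+1 / K n)).
  rewrite /w; move: (e _ _) (x ^+ n) (x ^+ _) (f n) => a b c u; ring.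
rewrite wE; apply: le_trans (ler_normD _ _) _.
rewrite /C0 [leRHS]mulrDl; apply: lerD => //; rewrite normrM -[leRHS]mulrA ler_wpM2l //.
apply: le_trans (ler_normB _ _) _; rewrite [leRHS]mulrDl; apply: lerD => //.
by rewrite ger0_norm.
Qed.

(** The same three errors, compared at 1 and x: one power of 1/n is traded for a factor 1 - x,
    through 1 - x^n <= n (1 - x). *)
Let w_diff n x : 0 <= x <= 1 -> `|w n 1 - w n x| <= C1 * (1 - x) / n.+1%:R.
Proof.
move=> x01; have /andP[x0 x1] := x01.
have x10 : 0 <= 1 - x by rewrite subr_ge0.
have XK : 1 - x ^+ (n + m).+1 <= K n * (1 - x) by apply: subr1X_le.
have Xn : 1 - x ^+ n <= n%:R * (1 - x) by apply: subr1X_le.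
have Xn0 : 0 <= 1 - x ^+ n by rewrite subr_ge0 exprn_ile1.
have XK0 : 0 <= 1 - x ^+ (n + m).+1 by rewrite subr_ge0 exprn_ile1.
have E1 : `|(f n - kappa / K n) * (1 - x ^+ n)| <= C * ((1 - x) / n.+1%:R).
  rewrite normrM (ger0_norm Xn0).
  apply: le_trans (ler_pM (normr_ge0 _) Xn0 (f_approx n) Xn) _.
  rewrite -mulrA ler_wpM2l // invfM mulrA -mulrA [leRHS]mulrC -mulrA ler_wpM2l ?invr_ge0 //.
  rewrite mulrA -[leRHS]mul1r ler_wpM2r // ler_pdivrMl // mulr1 ler_nat ltnW //.
have /andP[g0 g1] := expr_gap_le n x01.
have E2 : (x ^+ n - x ^+ (n + m).+1) / K n <= m.+1%:R * ((1 - x) / n.+1%:R).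
  by apply: le_trans g1 _; rewrite -mulrA ler_wpM2l // ler_wpM2l.
have E3 : `|e x (n + m).+1 - e 1 (n + m).+1 - (1 - x ^+ (n + m).+1) / K n|
    <= 3 * ((1 - x) / n.+1%:R).
  have := euler_factor_diff_approx x0 x1 (lexx 1) (ltn0Sn (n + m)).
  rewrite expr1n => /le_trans; apply.
  rewrite -mulrA ler_wpM2l //.
  apply: (@le_trans _ _ (K n ^- 2 * (K n * (1 - x)))).
    by rewrite ler_wpM2l // invr_ge0 exprn_ge0.
  rewrite expr2 invfM -mulrA mulKf ?gt_eqF // mulrC ler_wpM2l //.
have wE : w n 1 - w n x = (f n - kappa / K n) * (1 - x ^+ n)
    + kappa * (- ((x ^+ n - x ^+ (n + m).+1) / K n)
    - (e x (n + m).+1 - e 1 (n + m).+1 - (1 - x ^+ (n + m).+1) / K n)).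
  rewrite /w expr1n; move: (e _ _) (e _ _) (x ^+ n) (x ^+ _) (f n) => a a' b c' u; ring.
rewrite wE; apply: le_trans (ler_normD _ _) _.
rewrite /C1 -[leRHS]mulrA [leRHS]mulrDl; apply: lerD => //; rewrite normrM -[leRHS]mulrA ler_wpM2l //.
apply: le_trans (ler_normB _ _) _; rewrite [leRHS]mulrDl; apply: lerD => //.
by rewrite normrN ger0_norm.
Qed.

Let T_bound n x : 0 <= x <= 1 -> `|T n x| <= C0 / (n.+1%:R * n.+2%:R).
Proof.
move=> x01; have /andP[P0 P1] := euler_product_bounds (n + m) x01.
by rewrite normrM (gtr0_norm P0) (le_trans _ (w_bound n x01)) // ler_piMl.
Qed.

Let A : R := expR 5.
(** The first two summands serve n <= j, for the variation of [w] and of the Euler product; the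
    third serves n > j. *)
Let C2 := 2 * A * C1 + 2 * m.+1%:R * A * C0 + 2 * A * C0.

Let A_gt0 : 0 < A. Proof. exact: expR_gt0. Qed.

Let T_quotient_bound j n : `|(T n 1 - T n (xs j)) * j.+1%:R| <= C2 / (n.+1%:R * n.+2%:R).
Proof.
have x01 := xs_bounds' j; have /andP[x0 x1] := x01; set x := xs j in x01 x0 x1 *.
set z : R := 1 - x; have zE : z = j.+1%:R^-1 by rewrite /z /x /xs subKr.
have z0 : 0 < z by rewrite zE invr_gt0.
have -> : j.+1%:R = z^-1 by rewrite zE invrK.
have r0 := r_gt0 n; have rC c' : c' / (n.+1%:R * n.+2%:R) = c' * r n by [].
rewrite normrM [`|z^-1|]gtr0_norm ?invr_gt0 // ler_pdivrMr // rC.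
have n0 : 0 < n.+1%:R :> R by [].
have P1 : P 1 (n + m) <= A / n.+1%:R.
  apply: le_trans (euler_product_nonincreasing i01 (leq_addr m n)) _.
  by apply: euler_product_le => //; rewrite subrr mulr0.
have /andP[P10 _] := euler_product_bounds (n + m) i01.
have /andP[P0 _] := euler_product_bounds (n + m) x01.
have w1 := w_bound n i01; have wx := w_bound n x01.
have Pxn : (n <= j)%N -> P x (n + m) <= A / n.+1%:R.
  move=> nj; apply: le_trans (euler_product_nonincreasing x01 (leq_addr m n)) _.
  by apply: euler_product_le => //; rewrite -/z zE ler_pdivrMr // mul1r ler_nat leqW.
have in1 : n.+1%:R^-1 * n.+1%:R^-1 <= 2 * r n.
  by apply: le_trans (inv2_le n); rewrite -invfM -expr2.
case: (leqP n j) => nj.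
  have -> : T n 1 - T n x = P 1 (n + m) * (w n 1 - w n x) - (P x (n + m) - P 1 (n + m)) * w n x.
    rewrite /T; move: (P _ _) (P _ _) (w _ _) (w _ _) => a b a' b'; ring.
  apply: le_trans (ler_normB _ _) _; rewrite !normrM (gtr0_norm P10).
  have dP0 : 0 <= P x (n + m) - P 1 (n + m).
    rewrite subr_ge0 /P /euler_product; rewrite big_nat [leRHS]big_nat.
    apply: ler_prod => k /andP[k0 _].
    have /andP[e0 _] := euler_factor_bounds i01 k0; rewrite ltW //=.
    have /andP[L _] := euler_factor_diff x0 x1 (lexx 1) k0.
    rewrite -subr_ge0; apply: le_trans L; apply: mulr_ge0.
      apply: mulr_ge0; last exact: irreducible_density_ge0.
      by rewrite subr_ge0 invf_le1 ?ltr0n // ler1n.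
    by rewrite subr_ge0 expr1n exprn_ile1.
  rewrite (ger0_norm dP0).
  have B1 : P 1 (n + m) * `|w n 1 - w n x| <= 2 * A * C1 * r n * z.
    apply: (@le_trans _ _ (A / n.+1%:R * (C1 * z / n.+1%:R))).
      by apply: ler_pM => //; [exact: ltW | exact: w_diff].
    rewrite (_ : A / _ * _ = A * C1 * z * (n.+1%:R^-1 * n.+1%:R^-1)); last by ring.
    rewrite [leRHS](_ : _ = A * C1 * z * (2 * r n)); last by ring.
    by rewrite ler_wpM2l // !mulr_ge0 // ltW.
  have B2 : (P x (n + m) - P 1 (n + m)) * `|w n x| <= 2 * m.+1%:R * A * C0 * r n * z.
    rewrite [leRHS](_ : _ = (2 * m.+1%:R * A * z) * (C0 * r n)); last by ring.
    apply: ler_pM => //; apply: le_trans (euler_product_diff (n + m) x01) _.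
    rewrite -/z; apply: (@le_trans _ _ (2 * (n + m)%:R * z * (A / n.+1%:R))).
      by apply: ler_wpM2l (Pxn nj); rewrite !mulr_ge0 // ltW.
    rewrite [leLHS](_ : _ = 2 * A * z * ((n + m)%:R / n.+1%:R)); last by ring.
    rewrite [leRHS](_ : _ = 2 * A * z * m.+1%:R); last by ring.
    have Az0 : 0 <= 2 * A * z by rewrite mulr_ge0 ?mulr_ge0 ?(ltW A_gt0) ?(ltW z0).
    apply: (ler_wpM2l Az0); rewrite ler_pdivrMr // -natrM ler_nat.
    by rewrite mulSn leq_add // leq_pmulr.
  apply: le_trans (lerD B1 B2) _; rewrite /C2.
  have : 0 <= 2 * A * C0 * r n * z by rewrite !mulr_ge0 // ltW.
  have E (a b c' : R) : 0 <= c' * r n * z -> a * r n * z + b * r n * z <= (a + b + c') * r n * z.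
    by move: (r n) => t; lra.
  exact: E.
have jz : j%:R * z <= 1 by rewrite zE ler_pdivrMr // mul1r ler_nat.
have Px : P x (n + m) <= A * z.
  apply: le_trans (euler_product_nonincreasing x01 (_ : (j <= n + m)%N)) _.
    by rewrite (leq_trans (ltnW nj)) // leq_addr.
  by rewrite zE; apply: euler_product_le.
have B1 : `|T n 1| <= A * C0 * r n * z.
  rewrite normrM (gtr0_norm P10) [leRHS](_ : _ = A * z * (C0 * r n)); last by ring.
  apply: ler_pM => //; first exact: ltW.
  apply: le_trans P1 _; rewrite ler_wpM2l ?(ltW A_gt0) // zE lef_pV2 ?posrE //.
  by rewrite ler_nat ltnS ltnW.
have B2 : `|T n x| <= A * C0 * r n * z.
  rewrite normrM (gtr0_norm P0) [leRHS](_ : _ = A * z * (C0 * r n)); last by ring.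
  by apply: ler_pM => //; apply: ltW.
apply: le_trans (ler_normB _ _) _; apply: le_trans (lerD B1 B2) _; rewrite /C2.
have D1 : 0 <= 2 * A * C1 * r n * z by rewrite !mulr_ge0 // ltW.
have D2 : 0 <= 2 * m.+1%:R * A * C0 * r n * z by rewrite !mulr_ge0 // ltW.
have E (a b c' : R) : 0 <= a * r n * z -> 0 <= b * r n * z ->
  c' * r n * z + c' * r n * z <= (a + b + 2 * c') * r n * z by move: (r n) => t; lra.
by rewrite -[2 * A * C0]mulrA; apply: E.
Qed.

Let series_T x M : series (T^~ x) M =
  \sum_(0 <= n < M) f n * x ^+ n * P x (n + m) - kappa * (P x m - P x (m + M)).
Proof.
elim: M => [|M IH]; first by rewrite /series /= !big_geq // addn0 subrr mulr0 subrr.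
rewrite seriesSr IH big_nat_recr //= TE addnS [(M + m)%N]addnC.
move: (\sum_(_ <= _ < _) _) (P _ _) (P _ _) (P _ _) => a b c' u; ring.
Qed.

Let cvg_series_T x : 0 <= x < 1 ->
  series (T^~ x) @ \oo --> 1 - kappa * (P x m - (1 - x)).
Proof.
move=> /[dup] x01 /andP[x0 x1].
rewrite (_ : series (T^~ x) = (fun M => \sum_(0 <= n < M) f n * x ^+ n * P x (n + m)
    - kappa * (P x m - P x (m + M)))); last by apply/funext => M; apply: series_T.
have cE : (fun M => \sum_(0 <= n < M) f n * x ^+ n * P x (n + m)) @ \oo --> (1 : R).
  apply: (squeeze_cvgr (f := fun M => 1 - x ^+ M) (h := fun=> 1)).
  - by exists 0%N => // M _; apply: f_gf.
  - rewrite -[X in _ --> X]subr0; apply: cvgB; first exact: cvg_cst.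
    by apply: cvg_expr; rewrite ger0_norm.
  - exact: cvg_cst.
have cP : (fun M => P x (m + M)) @ \oo --> 1 - x.
  rewrite (_ : (fun M => _) = (fun M => P x (M + m))).
    by rewrite (cvg_shiftn m (P x)); apply: cvg_euler_product.
  by apply/funext => M; rewrite addnC.
apply: cvgB => //; apply: cvgM; first exact: cvg_cst.
by apply: cvgB => //; apply: cvg_cst.
Qed.

Let cvg_mul_j : (fun j => (xs j - 1) * j.+1%:R) @ \oo --> (- 1 : R).
Proof.
rewrite (_ : (fun j => _) = cst (-1)); first exact: cvg_cst.
by apply/funext => j; rewrite /xs addrAC subrr sub0r mulNr mulVf // pnatr_eq0.
Qed.

Let cvg_T n : (fun j => T n (xs j)) @ \oo --> T n 1.
Proof.
under eq_fun do rewrite TE; rewrite TE.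
have [c1 _] := has_logder_euler_product (n + m).
have [c2 _] := has_logder_euler_product (n + m).+1.
have cX : (fun j => xs j ^+ n) @ \oo --> (1 : R) ^+ n by apply: cvg_expr_seq.
apply: cvgB; first by apply: cvgM => //; apply: cvgM => //; apply: cvg_cst.
by apply: cvgM; [exact: cvg_cst | apply: cvgB].
Qed.

(** As [f_gf] covers only x < 1, the sum at 1 is found as a limit by [tannery]. *)
Let cvg_series_T1 : series (T^~ 1) @ \oo --> 1 - kappa * P 1 m.
Proof.
apply: (tannery (C := C0) (g := fun j => T^~ (xs j))
  (h := fun j => 1 - kappa * (P (xs j) m - (1 - xs j)))).
- by move=> j n; apply: T_bound.
- exact: cvg_T.
- by move=> j; apply: cvg_series_T.
have [c1 _] := has_logder_euler_product m.
rewrite (_ : P 1 m = P 1 m - (1 - 1)); last by rewrite subrr subr0.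
apply: cvgB; first exact: cvg_cst.
apply: cvgM; first exact: cvg_cst.
by apply: cvgB => //; apply: cvgB => //; apply: cvg_cst.
Qed.

Let a n : R := f n * (sg (n + m) - n%:R) * P 1 (n + m).

Let cvg_T_quotient n : (fun j => (T n 1 - T n (xs j)) * j.+1%:R) @ \oo -->
  - a n + kappa * (P 1 (n + m) * sg (n + m) - P 1 (n + m).+1 * sg (n + m).+1).
Proof.
have [_ d1] := has_logder_euler_product (n + m).
have [_ d2] := has_logder_euler_product (n + m).+1.
have [_ d3] := has_logderM (has_logderX n has_logder_id) (has_logder_euler_product (n + m)).
rewrite (_ : (fun j => _) = (fun j =>
  f n * ((1 ^+ n * P 1 (n + m) - xs j ^+ n * P (xs j) (n + m)) * j.+1%:R)
  - kappa * ((P 1 (n + m) - P (xs j) (n + m)) * j.+1%:R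
           - (P 1 (n + m).+1 - P (xs j) (n + m).+1) * j.+1%:R))); last first.
  apply/funext => j; rewrite !TE.
  move: (P _ _) (P _ _) (P _ _) (P _ _) (_ ^+ n) (_ ^+ n) => a1 a2 a3 a4 a5 a6; ring.
rewrite (_ : - a n + _ = f n * (1 ^+ n * P 1 (n + m) * (n%:R * 1 + - sg (n + m)))
  - kappa * (P 1 (n + m) * (- sg (n + m)) - P 1 (n + m).+1 * (- sg (n + m).+1))); last first.
  rewrite /a expr1n; move: (P _ _) (P _ _) (sg _) (sg _) => a1 a2 a3 a4; ring.
apply: cvgB; first by apply: cvgM; [exact: cvg_cst | exact: d3].
by apply: cvgM; [exact: cvg_cst | apply: cvgB; [exact: d1 | exact: d2]].
Qed.

Lemma cvg_gap_series : series a @ \oo --> kappa * (1 - expR (- euler_gamma R)).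
Proof.
set T' := fun n => - a n + kappa * (P 1 (n + m) * sg (n + m) - P 1 (n + m).+1 * sg (n + m).+1).
have [_ dm] := has_logder_euler_product m.
have main : series T' @ \oo --> kappa * (P 1 m * sg m - 1).
  apply: (tannery (C := C2) (g := fun j n => (T n 1 - T n (xs j)) * j.+1%:R)
    (h := fun j => (1 - kappa * P 1 m - (1 - kappa * (P (xs j) m - (1 - xs j)))) * j.+1%:R)).
  - exact: T_quotient_bound.
  - exact: cvg_T_quotient.
  - move=> j; rewrite (_ : series _ = (fun M => (series (T^~ 1) M - series (T^~ (xs j)) M) * j.+1%:R)).
      apply: cvgM; last exact: cvg_cst.
      by apply: cvgB; [exact: cvg_series_T1 | apply: cvg_series_T].
    by apply/funext => M; rewrite /series /= -sumrB mulr_suml.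
  rewrite (_ : (fun j => _) = (fun j => - kappa * ((P 1 m - P (xs j) m) * j.+1%:R)
      + kappa * ((xs j - 1) * j.+1%:R))); last first.
    by apply/funext => j; move: (P _ _) (P _ _) => a1 a2; ring.
  rewrite (_ : kappa * _ = - kappa * (P 1 m * - sg m) + kappa * (-1)); last by ring.
  apply: cvgD; apply: cvgM => //; exact: cvg_cst.
(* Undoes the telescoping part of [T']. In the limit the two copies of [P 1 m * sg m] cancel,
   leaving 1 - exp(- gamma). *)
have E M : series a M = kappa * (P 1 m * sg m - P 1 (M + m) * sg (M + m)) - series T' M.
  elim: M => [|M IH]; first by rewrite /series /= !big_geq // add0n subrr mulr0 subrr.
  rewrite !seriesSr IH /T' addSn.
  move: (P _ _) (P _ _) (P _ _) (sg _) (sg _) (sg _) (a _) (series _ _) => a1 a2 a3 a4 a5 a6 a7 a8.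
  ring.
rewrite (funext E).
rewrite (_ : kappa * _ = kappa * (P 1 m * sg m - expR (- euler_gamma R))
  - kappa * (P 1 m * sg m - 1)); last by ring.
apply: cvgB => //; apply: cvgM; first exact: cvg_cst.
apply: cvgB; first exact: cvg_cst.
by rewrite (cvg_shiftn m (fun N => P 1 N * sg N)); apply: cvg_euler_product_derivative.
Qed.
End EulerFactors.

(** * The gap constant *)

Lemma sum_diagonals (R : nmodType) (h : nat -> nat -> R) M :
  \sum_(0 <= N < M) \sum_(0 <= n < N.+1) h n (N - n)%N =
  \sum_(0 <= n < M) \sum_(0 <= r < M - n) h n r.
Proof.
elim: M => [|M IH]; first by rewrite !big_geq.
rewrite big_nat_recr //= IH [RHS]big_nat_recr //= subSn // subnn big_nat1.
rewrite [X in _ + X]big_nat_recr //= subnn addrA; congr (_ + _).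
rewrite -big_split; apply: eq_big_nat => n /andP[_ nM] /=.
by rewrite subSn ?(ltnW nM) // big_nat_recr.
Qed.

(** The rectangle of sides [M] and [K] lies in the triangle of side [M + K]. *)
Lemma ler_sum_diagonals (R : numDomainType) (h : nat -> nat -> R) M K :
    (forall n r, 0 <= h n r) ->
  \sum_(0 <= n < M) \sum_(0 <= r < K) h n r <=
  \sum_(0 <= n < M + K) \sum_(0 <= r < M + K - n) h n r.
Proof.
move=> h0; rewrite [leRHS](big_cat_nat (n := M)) ?leq_addr //= -[leLHS]addr0.
apply: lerD; last by rewrite !sumr_ge0 // => n _; rewrite sumr_ge0.
rewrite big_nat [leRHS]big_nat; apply: ler_sum => n /andP[_ nM].
rewrite [leRHS](big_cat_nat (n := K)) //=; last lia.
by rewrite lerDl sumr_ge0.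
Qed.

Section GapProportion.
Variables (R : realType) (F : finFieldType) (m : nat).
Let q : R := #|F|%:R.
Let I := num_monic_irreducible F.
Let f n := gap_proportion F R n m.

Let q_gt0 : 0 < q. Proof. by rewrite ltr0n ltnW ?finRing_gt1. Qed.

Lemma gap_proportion_bounds n : 0 <= f n <= 1.
Proof.
rewrite /f gap_proportionE divr_ge0 ?exprn_ge0 ?(ltW q_gt0) //=.
rewrite ler_pdivrMr ?exprn_gt0 // mul1r -natrX ler_nat -size_monics.
exact: count_size.
Qed.

(** By [dense_rough_count], the terms [h n r] with n + r = N sum to x^N, so triangles have explicit
    sums. The lower bound keeps the triangle of side [M] inside the double sum; the upper bound
    encloses each rectangle in a triangle. *)
Lemma gap_proportion_gf (x : R) M : 0 <= x < 1 ->
  1 - x ^+ M <= \sum_(0 <= n < M) f n * x ^+ n * euler_product q I x (n + m) <= 1.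
Proof.
move=> /[dup] x01 /andP[x0 x1]; have x1' : 0 < 1 - x by rewrite subr_gt0.
pose u y r : R := (coprime_count (irreducibles F y) r)%:R * (x / q) ^+ r.
pose h n r := f n * x ^+ n * u (n + m)%N r.
have z0 : 0 <= x / q by rewrite divr_ge0 // ltW.
have u0 y r : 0 <= u y r by rewrite mulr_ge0 // exprn_ge0.
have fx0 n : 0 <= f n * x ^+ n.
  by rewrite mulr_ge0 ?exprn_ge0 //; case/andP: (gap_proportion_bounds n).
have h0 n r : 0 <= h n r by rewrite mulr_ge0.
have cu y : series (u y) @ \oo --> euler_product q I x y / (1 - x).
  by rewrite -prod_irreducibles; apply: cvg_coprime_count_series => //; apply: irreducibles_list.
have diag N : \sum_(0 <= n < N.+1) h n (N - n)%N = x ^+ N.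
  have Q0 : q ^+ N != 0 by rewrite gt_eqF // exprn_gt0.
  apply: (mulIf Q0); rewrite -[in RHS]natrX [in RHS](dense_rough_count F m N).
  rewrite natr_sum mulr_sumr mulr_suml; apply: eq_big_nat => n /andP[_ nN].
  rewrite /h /u /f gap_proportionE -/q natrM.
  have qn : q ^+ n != 0 by rewrite gt_eqF // exprn_gt0.
  have qNn : q ^+ (N - n) != 0 by rewrite gt_eqF // exprn_gt0.
  have E (t : R) : t ^+ N = t ^+ n * t ^+ (N - n) by rewrite -exprD subnKC.
  rewrite [q ^+ N]E [x ^+ N]E expr_div_n.
  move: (q ^+ n) (q ^+ (N - n)) qn qNn (x ^+ n) (x ^+ (N - n)) => a b a0 b0 s t.
  by move: (_%:R) (_%:R) => e e'; field; apply/andP.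
have geom L : \sum_(0 <= N < L) \sum_(0 <= n < N.+1) h n (N - n)%N = (1 - x ^+ L) / (1 - x).
  under eq_bigr do rewrite diag.
  have E : (\sum_(0 <= N < L) x ^+ N) * (1 - x) = 1 - x ^+ L.
    rewrite -[RHS]opprB -[X in x ^+ L - X](expr0 x) -telescope_sumr // -sumrN mulr_suml.
    by apply: eq_bigr => r _; rewrite exprS; ring.
  by rewrite -E mulfK // gt_eqF.
have sE : \sum_(0 <= n < M) f n * x ^+ n * euler_product q I x (n + m) =
    (\sum_(0 <= n < M) f n * x ^+ n * (euler_product q I x (n + m) / (1 - x))) * (1 - x).
  by rewrite mulr_suml; apply: eq_bigr => n _; rewrite mulrA divfK // gt_eqF.
rewrite sE; apply/andP; split.
  rewrite -ler_pdivrMr // -geom sum_diagonals; apply: ler_sum => n _; rewrite /h -mulr_sumr.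
  apply: ler_wpM2l => //; apply: (ler_cvg_to (f := fun=> series (u (n + m)%N) (M - n)%N) _ (cu _)).
    exact: cvg_cst.
  exists (M - n)%N => // L /= ML; rewrite /series /= [leRHS](big_cat_nat (n := (M - n)%N)) //=.
  by rewrite lerDl sumr_ge0.
rewrite -ler_pdivlMr // div1r.
have cS : (fun L => \sum_(0 <= n < M) f n * x ^+ n * series (u (n + m)%N) L) @ \oo -->
    \sum_(0 <= n < M) f n * x ^+ n * (euler_product q I x (n + m) / (1 - x)).
  by apply: cvg_sum_nat => n; apply: cvgM; [exact: cvg_cst | exact: cu].
apply: (ler_cvg_to (g := fun=> (1 - x)^-1) cS); first exact: cvg_cst.
exists 0%N => // L _ /=.
under eq_bigr do rewrite /series /= mulr_sumr.
apply: le_trans (ler_sum_diagonals M L h0) _.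
rewrite -sum_diagonals geom ler_pdivrMr // mulVf ?gt_eqF // gerBl exprn_ge0 //.
Qed.

(** Moves the denominator from n + m to n + m + 1, the index of the Euler factor to be matched. [Ca]
    serves n >= m; [Cb] serves the finitely many n < m, where the asymptotic says nothing and
    trivial bounds do. *)
Lemma gap_proportion_approx (c : R) : (0 < m)%N -> is_gap_constant F m c ->
  exists C, forall n,
    `|f n - c * m%:R / (n + m).+1%:R| <= C / (n.+1%:R * n.+2%:R).
Proof.
move=> m0 [c0 [K [err H]]]; set k := c * m%:R.
have k0 : 0 <= k by rewrite mulr_ge0 // ltW.
pose Ca := k * (1 + 3 * `|K| * (1 + m%:R ^+ 2)).
pose Cb := (1 + k) * (m.+1%:R * m.+2%:R).
have Ca0 : 0 <= Ca.
  by rewrite mulr_ge0 // addr_ge0 // !mulr_ge0 // addr_ge0 // exprn_ge0.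
have Cb0 : 0 <= Cb by rewrite !mulr_ge0 // addr_ge0.
exists (Ca + Cb) => n; have r0 : 0 < n.+1%:R * n.+2%:R :> R by rewrite mulr_gt0.
have s0 : 0 < (n + m).+1%:R :> R by [].
rewrite mulrDl; case: (leqP m n) => [mn|nm]; last first.
  apply: (@le_trans _ _ (Cb / (n.+1%:R * n.+2%:R))); last first.
    by rewrite lerDr divr_ge0 // ltW.
  have /andP[f0 f1] := gap_proportion_bounds n.
  have kk : 0 <= k / (n + m).+1%:R <= k.
    by rewrite divr_ge0 //= ler_pdivrMr // ler_peMr // ler1n.
  apply: (@le_trans _ _ (1 + k)).
    case/andP: kk => kk0 kk1.
    have E (s t : R) : 0 <= s -> s <= 1 -> 0 <= t -> t <= k -> `|s - t| <= 1 + k.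
      by move=> *; rewrite ler_norml; apply/andP; split; lra.
    exact: E.
  rewrite ler_pdivlMr // /Cb ler_wpM2l ?addr_ge0 //.
  by apply: ler_pM => //; rewrite ler_nat !ltnS ltnW.
have [fE errb] := H n mn.
apply: (@le_trans _ _ (Ca / (n.+1%:R * n.+2%:R))); last first.
  by rewrite lerDl divr_ge0 // ltW.
have n1 : 1 <= n%:R :> R by rewrite ler1n (leq_trans m0).
have m1 : 1 <= m%:R :> R by rewrite ler1n.
rewrite /f fE -/k; have -> : k / (n + m)%:R * (1 + err n) - k / (n + m).+1%:R =
    k * (((n + m)%:R * (n + m).+1%:R)^-1 + err n / (n + m)%:R).
  rewrite -(natr1 (n + m)) natrD; field; apply/andP; split; apply: lt0r_neq0; lra.
rewrite normrM (ger0_norm k0) /Ca -[leRHS]mulrA ler_wpM2l //.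
apply: le_trans (ler_normD _ _) _; rewrite [leRHS]mulrDl mul1r; apply: lerD.
  rewrite ger0_norm; last by rewrite invr_ge0 mulr_ge0.
  rewrite lef_pV2 ?posrE // ?mulr_gt0 ?ltr0n ?addn_gt0 ?m0 ?orbT //.
  by apply: ler_pM => //; rewrite ler_nat; lia.
rewrite normrM (ger0_norm (_ : 0 <= (n + m)%:R^-1)); last by rewrite invr_ge0.
have eb : `|err n| <= `|K| * (1 + m%:R ^+ 2) / n%:R.
  apply: le_trans errb _.
  apply: (@le_trans _ _ (`|K| * (n%:R^-1 + m%:R ^+ 2 / n%:R ^+ 2))).
    by rewrite ler_wpM2r ?ler_norm // addr_ge0 ?invr_ge0 // divr_ge0 ?exprn_ge0.
  rewrite -mulrA ler_wpM2l // mulrDl mul1r lerD2l ler_wpM2l ?exprn_ge0 //.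
  rewrite lef_pV2 ?posrE ?exprn_gt0 //; try lra.
  by rewrite expr2 ler_peMl //; lra.
have -> : 3 * `|K| * (1 + m%:R ^+ 2) / (n.+1%:R * n.+2%:R) =
    (`|K| * (1 + m%:R ^+ 2)) * (3 / (n.+1%:R * n.+2%:R)) by ring.
rewrite [leLHS](_ : _ = `|err n| * (n + m)%:R^-1) //.
(* The factor 3 in [Ca] comes from 1/(n(n+1)) <= 3/((n+1)(n+2)), valid for n >= 1. *)
apply: (@le_trans _ _ (`|K| * (1 + m%:R ^+ 2) / n%:R / n.+1%:R)).
  apply: ler_pM => //.
  rewrite lef_pV2 ?posrE ?ltr0n ?addn_gt0 ?m0 ?orbT // ler_nat; lia.
rewrite -mulrA ler_wpM2l ?mulr_ge0 ?addr_ge0 ?exprn_ge0 //.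
rewrite -(natr1 n.+1) -(natr1 n); move: (n%:R : R) n1 => z z1.
have -> : 3 / ((z + 1) * (z + 1 + 1)) = (z^-1 / (z + 1)) * (3 * z / (z + 1 + 1)).
  by field; rewrite !gt_eqF //; lra.
apply: ler_peMr; first by rewrite divr_ge0 ?invr_ge0 //; lra.
by rewrite ler_pdivlMr; lra.
Qed.

End GapProportion.

Theorem theorem1p3 (R : realType) (F : finFieldType) (m : nat) (c : R)
    (hm : (1 <= m)%N) (hc : is_gap_constant F m c) :
  let q : R := #|F|%:R in
  let f := gap_proportion F R in
  let I := num_monic_irreducible F in
  let a := fun n : nat =>
    f n m
    * (\sum_(1 <= k < (n + m).+1) (k%:R * (I k)%:R / (q ^+ k - 1)) - n%:R)
    * \prod_(1 <= k < (n + m).+1) (1 - 1 / q ^+ k) ^+ I k in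
  cvgn (series a) /\
  c = (1 / m%:R) / (1 - expR (- euler_gamma R)) * limn (series a).
Proof.
move=> q f I a.
have q2 : 2 <= q by rewrite /q ler_nat finRing_gt1.
have I_le k : (0 < k)%N -> k%:R * (I k)%:R <= q ^+ k.
  by move=> k0; rewrite -natrM -natrX ler_nat muln_num_monic_irreducible_le.
have I_ge k : (0 < k)%N -> k%:R * q ^+ k <= k%:R * (k%:R * (I k)%:R) + 2 * q ^+ k.
  by move=> k0; rewrite -natrX -!natrM -natrD ler_nat muln_num_monic_irreducible_ge.
have [C f_approx] := gap_proportion_approx hm hc.
have ca : series a @ \oo --> c * m%:R * (1 - expR (- euler_gamma R)).
  have := cvg_gap_series q2 I_le I_ge (@euler_product_gf_bounds F R) hm
    (@gap_proportion_gf R F m) f_approx.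
  rewrite (_ : (fun n => _) = a) //; apply/funext => n; rewrite /a /log_derivative_sum.
  by congr (_ * _); apply: eq_bigr => k _; rewrite /euler_factor expr_div_n expr1n.
split; first by apply/cvg_ex; eexists; exact: ca.
rewrite (cvg_lim _ ca) //; field; apply/andP; split.
  by rewrite subr_eq0 eq_sym lt_eqF // -expR0 ltr_expR oppr_lt0 euler_gamma_gt0.
by rewrite pnatr_eq0 -lt0n.
Qed.
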